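(* Let $n\geq m\geq 1$ be integers, and let $h(n,m)=\operatorname{hdepth}(S_{n,m}/I_{n,m})$, where $S_{n,m}=K[x_1,\ldots,x_n,y_1,\ldots,y_m]$ and $I_{n,m}=(x_iy_j : 1\leq i\leq n,\ 1\leq j\leq m)$. Let $s,t$ be integers. (1) If $n=2s$ and $m=s+t$, with $t\in \left( \frac{1-\sqrt{1+8s}}{2}, \frac{1+\sqrt{1+8s}}{2} \right)$, then $h(n,m)=s$. (2) If $n=2s+1$ and $m=s+1+t$, with $t\in \left( \frac{1-\sqrt{9+16s}}{2}, \frac{1+\sqrt{9+16s}}{2} \right)$, then $h(n,m)=s+1$.
   Context: $K$ is a field. Polynomial rings over $K$ carry the standard grading (each variable has degree 1). For a finitely generated graded module $M$ over a polynomial ring $S$ over $K$, the Hilbert depth $\operatorname{hdepth}(M)$ is the maximal depth of a finitely generated graded $S$-module $N$ having the same Hilbert series as $M$. The ideal $I_{n,m}$ is the edge ideal of the complete bipartite graph $K_{n,m}$. *)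

(* Defs.v *)
From HB Require Import structures.
From mathcomp Require Import all_boot all_order all_algebra.
From mathcomp Require Import boolp reals.
From mathcomp Require Import mpoly.

Set Implicit Arguments.
Unset Strict Implicit.
Unset Printing Implicit Defensive.

Import Order.TTheory GRing.Theory Num.Theory.
Local Open Scope ring_scope.
Local Open Scope quotient_scope.

Definition is_max (P : nat -> Prop) (n : nat) : Prop :=
  P n /\ forall k : nat, P k -> (k <= n)%N.

(* Z-graded modules over K[X_0, ..., X_(k-1)] with its standard grading. *)
Record gradedModule (K : fieldType) (k : nat) := GradedModule {
  gmod :> lmodType {mpoly K[k]};
  gcomp : int -> gmod -> Prop;
  gcomp0 : forall d, gcomp d 0;
  gcompB : forall d u v, gcomp d u -> gcomp d v -> gcomp d (u - v);
  gcompZ : forall (e : nat) (d : int) (p : {mpoly K[k]}) v,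
    p \is e.-homog -> gcomp d v -> gcomp (e%:Z + d) (p *: v);
  gcomp_sum : forall v : gmod, exists (ds : seq int) (u : int -> gmod),
    [/\ uniq ds, forall d, gcomp d (u d) & v = \sum_(d <- ds) u d];
  gcomp_direct : forall (ds : seq int) (u : int -> gmod),
    uniq ds -> (forall d, gcomp d (u d)) -> \sum_(d <- ds) u d = 0 ->
    {in ds, forall d, u d = 0}
}.

Section GradedModules.
Variables (K : fieldType) (k : nat).
Local Notation S := {mpoly K[k]}.

Definition fin_gen (M : lmodType S) : Prop :=
  exists (r : nat) (g : 'I_r -> M),
    forall v, exists c : 'I_r -> S, v = \sum_(i < r) c i *: g i.

Definition has_dim (M : lmodType S) (V : M -> Prop) (r : nat) : Prop :=
  exists e : 'I_r -> M,
    [/\ forall i, V (e i),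
        forall c : 'I_r -> K,
          \sum_(i < r) (c i)%:MP *: e i = 0 -> forall i, c i = 0
      & forall v, V v -> exists c : 'I_r -> K,
          v = \sum_(i < r) (c i)%:MP *: e i].

(* The Hilbert series sum_d (H d) t^d is represented by its coefficients. *)
Definition hilbert_series (M : gradedModule K k) (H : int -> nat) : Prop :=
  forall d, has_dim (gcomp (g:=M) d) (H d).

Definition same_hilbert_series (M N : gradedModule K k) : Prop :=
  exists H, hilbert_series M H /\ hilbert_series N H.

(* Membership in (a_0, ..., a_(r-1)) M, where rs = [:: a_0; ...; a_(r-1)]. *)
Definition seq_mul (M : lmodType S) (rs : seq S) (v : M) : Prop :=
  exists u : 'I_(size rs) -> M, v = \sum_(i < size rs) rs`_i *: u i.

Definition regular_seq (M : lmodType S) (rs : seq S) : Prop :=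
  (forall i, (i < size rs)%N -> forall v : M,
     seq_mul (take i rs) (rs`_i *: v) -> seq_mul (take i rs) v)
  /\ exists v : M, ~ seq_mul rs v.

(* p is in (X_0, ..., X_(k-1)) iff its constant coefficient vanishes. *)
Definition is_depth (M : lmodType S) : nat -> Prop :=
  is_max (fun r => exists rs : seq S,
    [/\ size rs = r, {in rs, forall p : S, p@_0%MM = 0} & regular_seq M rs]).

Definition is_hdepth (M : gradedModule K k) : nat -> Prop :=
  is_max (fun r => exists N : gradedModule K k,
    [/\ fin_gen N, same_hilbert_series M N & is_depth N r]).

End GradedModules.

Section BipartiteEdgeIdeal.
Variables (K : fieldType) (n m : nat).
Local Notation S := {mpoly K[n + m]}.

Definition xvar (i : 'I_n) : S := 'X_(lshift m i).
Definition yvar (j : 'I_m) : S := 'X_(rshift n j).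

Definition Knm_ideal : {pred S} := fun p =>
  `[< exists c : 'I_n -> 'I_m -> S,
        p = \sum_(i < n) \sum_(j < m) c i j * (xvar i * yvar j) >].

Lemma Knm_idealP p :
  reflect (exists c : 'I_n -> 'I_m -> S,
            p = \sum_(i < n) \sum_(j < m) c i j * (xvar i * yvar j))
          (p \in Knm_ideal).
Proof. exact: asboolP. Qed.

Lemma Knm_ideal_zmod_closed : zmod_closed Knm_ideal.
Proof.
split=> [|p q].
  apply/Knm_idealP; exists (fun _ _ => 0).
  by rewrite big1 // => i _; rewrite big1 // => j _; rewrite mul0r.
move=> /Knm_idealP[c ->] /Knm_idealP[d ->]; apply/Knm_idealP.
exists (fun i j => c i j - d i j); rewrite -sumrB; apply: eq_bigr => i _.
by rewrite -sumrB; apply: eq_bigr => j _; rewrite mulrBl.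
Qed.

HB.instance Definition _ :=
  GRing.isZmodClosed.Build S Knm_ideal Knm_ideal_zmod_closed.

Lemma Knm_idealM p q : q \in Knm_ideal -> p * q \in Knm_ideal.
Proof.
move=> /Knm_idealP[c ->]; apply/Knm_idealP; exists (fun i j => p * c i j).
rewrite mulr_sumr; apply: eq_bigr => i _.
by rewrite mulr_sumr; apply: eq_bigr => j _; rewrite mulrA.
Qed.

Lemma Knm_ideal_pihomog d p :
  p \in Knm_ideal -> pihomog mdeg d p \in Knm_ideal.
Proof.
have homX i j : xvar i * yvar j \is 2.-homog.
  by apply: (@dhomogM _ _ mdeg 1 _ 1); rewrite dhomogX; apply/eqP; exact: mdeg1.
have pihomogMX (q r : S) : r \is 2.-homog ->
    exists q', pihomog mdeg d (q * r) = q' * r.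
  move=> r2; pose N := msize q.
  have qE : q = \sum_(e < N) pihomog mdeg e q by exact: pihomog_partitionE.
  rewrite {1}qE mulr_suml raddf_sum /=.
  exists (\sum_(e < N | (e + 2)%N == d) pihomog mdeg e q).
  rewrite mulr_suml [RHS]big_mkcond; apply: eq_bigr => e _.
  have h : pihomog mdeg e q * r \is (e + 2).-homog.
    by apply: dhomogM => //; exact: pihomogP.
  case: eqVneq => [<-|ne]; first exact: pihomog_dE.
  exact: (pihomog_ne0 ne h).
move=> /Knm_idealP[c ->]; apply/Knm_idealP.
have /choice[c' c'P] (ij : 'I_n * 'I_m) : exists q',
    pihomog mdeg d (c ij.1 ij.2 * (xvar ij.1 * yvar ij.2)) =
    q' * (xvar ij.1 * yvar ij.2) by exact: pihomogMX.
exists (fun i j => c' (i, j)); rewrite raddf_sum; apply: eq_bigr => i _.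
by rewrite raddf_sum; apply: eq_bigr => j _; rewrite -c'P.
Qed.

Definition Knm_quot := {ideal_quot Knm_ideal}.
HB.instance Definition _ := GRing.Zmodule.on Knm_quot.

Definition Knm_proj (p : S) : Knm_quot := \pi_({ideal_quot Knm_ideal}) p.

Lemma Knm_proj_is_zmod_morphism : zmod_morphism Knm_proj.
Proof. by move=> p q; rewrite /Knm_proj raddfB. Qed.

HB.instance Definition _ :=
  GRing.isZmodMorphism.Build S Knm_quot Knm_proj Knm_proj_is_zmod_morphism.

Lemma Knm_proj_eq p q : Knm_proj p = Knm_proj q <-> p - q \in Knm_ideal.
Proof. by rewrite Quotient.idealrBE; split=> [/eqP|/eqP]. Qed.

Lemma Knm_proj_eq0 p : Knm_proj p = 0 <-> p \in Knm_ideal.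
Proof. by rewrite -{1}(raddf0 Knm_proj) Knm_proj_eq subr0. Qed.

Definition Knm_repr (v : Knm_quot) : S := repr (v : {ideal_quot Knm_ideal}).

Lemma Knm_reprK : cancel Knm_repr Knm_proj.
Proof. exact: reprK. Qed.

Definition Knm_scale (p : S) (v : Knm_quot) : Knm_quot :=
  Knm_proj (p * Knm_repr v).

Lemma Knm_scale_proj p q : Knm_scale p (Knm_proj q) = Knm_proj (p * q).
Proof.
apply/Knm_proj_eq; rewrite -mulrBr; apply: Knm_idealM; apply/Knm_proj_eq.
exact: Knm_reprK.
Qed.

Lemma Knm_scaleA p q v : Knm_scale p (Knm_scale q v) = Knm_scale (p * q) v.
Proof. by rewrite {2}/Knm_scale Knm_scale_proj mulrA. Qed.

Lemma Knm_scale1 : left_id 1 Knm_scale.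
Proof. by move=> v; rewrite /Knm_scale mul1r Knm_reprK. Qed.

Lemma Knm_scaleDr : right_distributive Knm_scale +%R.
Proof.
move=> p u v; rewrite -(Knm_reprK u) -(Knm_reprK v) -raddfD !Knm_scale_proj.
by rewrite mulrDr raddfD.
Qed.

Lemma Knm_scaleDl v : {morph Knm_scale^~ v : p q / p + q}.
Proof. by move=> p q; rewrite /Knm_scale mulrDl raddfD. Qed.

HB.instance Definition _ := GRing.Zmodule_isLmodule.Build S Knm_quot
  Knm_scaleA Knm_scale1 Knm_scaleDr Knm_scaleDl.

Lemma Knm_projM p q : Knm_proj (p * q) = p *: Knm_proj q.
Proof. by rewrite -Knm_scale_proj. Qed.

(* Image of the forms of degree d; these are all 0 when d < 0. *)
Definition Knm_comp (d : int) (v : Knm_quot) : Prop :=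
  exists2 p : S, {in msupp p, forall mu, (mdeg mu)%:Z = d} & v = Knm_proj p.

Lemma Knm_comp_homog (e : nat) v :
  Knm_comp e v <-> exists2 p : S, p \is e.-homog & v = Knm_proj p.
Proof.
split=> -[p hp ->]; exists p => //; first by apply/dhomogP => mu /hp[].
by move=> mu mup; rewrite (dhomog_mf hp).
Qed.

Lemma Knm_comp_neg (e : nat) v : Knm_comp (Negz e) v <-> v = 0.
Proof.
split=> [[p hp ->]|->]; last by exists 0; rewrite ?raddf0 // msupp0.
suff -> : p = 0 by rewrite raddf0.
apply/mpolyP => mu; rewrite mcoeff0; apply/memN_msupp_eq0/negP.
by move=> /hp.
Qed.

Lemma Knm_comp0 d : Knm_comp d 0.
Proof. by exists 0; rewrite ?raddf0 // msupp0. Qed.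

Lemma Knm_compB d u v : Knm_comp d u -> Knm_comp d v -> Knm_comp d (u - v).
Proof.
move=> [p hp ->] [q hq ->]; exists (p - q); last by rewrite raddfB.
by move=> mu /msuppB_le; rewrite mem_cat => /orP[/hp|/hq].
Qed.

Lemma Knm_compZ (e : nat) (d : int) (p : S) v :
  p \is e.-homog -> Knm_comp d v -> Knm_comp (e%:Z + d) (p *: v).
Proof.
move=> hp [q hq ->]; exists (p * q); last by rewrite Knm_projM.
move=> mu /msuppM_le/allpairsP[[m1 m2] /= [/(dhomog_mf hp) <- /hq <- ->]].
by rewrite mdegD PoszD.
Qed.

Lemma Knm_comp_sum (v : Knm_quot) : exists (ds : seq int) (u : int -> Knm_quot),
  [/\ uniq ds, forall d, Knm_comp d (u d) & v = \sum_(d <- ds) u d].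
Proof.
pose p := Knm_repr v.
exists [seq Posz e | e <- iota 0 (msize p)].
exists (fun d => if d is Posz e then Knm_proj (pihomog mdeg e p) else 0).
split; first by rewrite map_inj_uniq ?iota_uniq // => ? ? [].
- case=> e; last exact: Knm_comp0.
  by apply/Knm_comp_homog; exists (pihomog mdeg e p) => //; exact: pihomogP.
rewrite -(Knm_reprK v) -/p big_map.
rewrite [in LHS](@pihomog_partitionE _ _ mdeg (msize p) p) // raddf_sum /=.
have -> : iota 0 (msize p) = index_iota 0 (msize p) by rewrite /index_iota subn0.
by rewrite big_mkord.
Qed.

Lemma Knm_comp_direct (ds : seq int) (u : int -> Knm_quot) :
  uniq ds -> (forall d, Knm_comp d (u d)) -> \sum_(d <- ds) u d = 0 ->
  {in ds, forall d, u d = 0}.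
Proof.
move=> dsU hu; have /choice[q qP] d : exists p : S,
    {in msupp p, forall mu, (mdeg mu)%:Z = d} /\ u d = Knm_proj p.
  by have [p ? ?] := hu d; exists p.
under eq_bigr => d _ do rewrite (qP d).2.
rewrite -raddf_sum => /Knm_proj_eq0 sI [e|e] eds; last first.
  by apply/(Knm_comp_neg e).
rewrite (qP _).2; apply/Knm_proj_eq0.
have := Knm_ideal_pihomog e sI.
rewrite raddf_sum (bigD1_seq (Posz e)) //= big1 ?addr0; last first.
  move=> d de; rewrite pihomogE big1_seq // => mu /andP[/eqP mue].
  by move=> /(qP d).1; rewrite mue => ed; rewrite ed eqxx in de.
by rewrite pihomog_dE //; apply/dhomogP => mu /(qP _).1[].
Qed.

Definition Knm_module : gradedModule K (n + m) :=
  GradedModule Knm_comp0 Knm_compB Knm_compZ Knm_comp_sum Knm_comp_direct.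

Lemma Knm_module_fin_gen : fin_gen Knm_module.
Proof.
exists 1%N, (fun=> Knm_proj 1) => v; exists (fun=> Knm_repr v).
by rewrite big_ord1 -[LHS]Knm_reprK -[in LHS](mulr1 (Knm_repr v)) Knm_projM.
Qed.

End BipartiteEdgeIdeal.

(* Main.v *)
(* Write D f for the coefficient sequence of (1 - z) f(z).

   Upper bound: if N has a regular sequence of length r in the irrelevant ideal,
   then D^r of its Hilbert function is nonnegative.  The sequence need not be
   homogeneous, and K may be finite, so no regular linear forms need exist over
   K.  Instead, a regular sequence of length r makes the Koszul cohomology of
   (X_0, X_1, ...) vanish below r, a condition that survives base change to
     K(a),
   where a is transcendental over K.  Over K(a) the linear form sum_i a^i X_i is
   injective as soon as N has no socle (McCoy), and dividing by it applies D to
   the Hilbert function and lowers the vanishing range by one.  For S/I the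
   coefficient of z^2 in (1 - z)^(h + 1) H is negative exactly under the
   hypothesis on t.

   Lower bound: H = 1/(1-z)^n + 1/(1-z)^m - 1 is a finite sum of series
   z^d/(1-z)^q with h <= q <= n, where h = ceil(n/2), hence the Hilbert series
   of a direct sum of shifted polynomial rings in q variables, on which the
     first
   h variables form a regular sequence. *)
From HB Require Import structures.
Require Import Defs.
From mathcomp Require Import all_boot all_order all_algebra.
From mathcomp Require Import boolp reals mpoly generic_quotient zify ring lra.

Set Implicit Arguments.
Unset Strict Implicit.
Unset Printing Implicit Defensive.

Import Order.TTheory GRing.Theory Num.Theory.
Local Open Scope ring_scope.

(** * Koszul cohomology and regular sequences *)

Section KoszulDifferential.
Variable I : Type.

(* Cochains are arbitrary functions on lists, neither alternating nor restricted
   to increasing lists: the cohomology still vanishes in the range needed, and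
   the recursion makes every identity sign-free. *)
Fixpoint koszul (M M' : zmodType) (x : I -> M -> M') (c : seq I -> M)
    (J : seq I) : M' :=
  if J is j :: J' then x j (c J') - koszul x (fun L => c (j :: L)) J' else 0.

Lemma eq_koszul (M M' : zmodType) (x y : I -> M -> M') (c e : seq I -> M) J :
  (forall i, x i =1 y i) ->
  (forall L, (size L).+1 = size J -> c L = e L) ->
  koszul x c J = koszul y e J.
Proof.
move=> exy; elim: J c e => //= j J IH c e ce; rewrite exy ce //; congr (_ - _).
by apply: IH => L sL; apply: ce; rewrite -sL.
Qed.

Lemma koszul_sum (M M' : zmodType) (x : I -> M -> M')
    (xB : forall i, zmod_morphism (x i)) (A : Type) (s : seq A)
    (c : A -> seq I -> M) J :
  koszul x (fun L => \sum_(a <- s) c a L) J = \sum_(a <- s) koszul x (c a) J.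
Proof.
elim: J c => [|j J IH] c /=; first by rewrite big1.
have x0 : x j 0 = 0 by rewrite -[X in x j X](subrr 0) xB subrr.
have xD u v : x j (u + v) = x j u + x j v.
  by rewrite -[v in LHS]opprK xB -[- v]sub0r xB x0 sub0r opprK.
by rewrite (big_morph _ xD x0) IH sumrB.
Qed.

Lemma koszulB (M M' : zmodType) (x : I -> M -> M')
    (xB : forall i, zmod_morphism (x i)) (c e : seq I -> M) J :
  koszul x (fun L => c L - e L) J = koszul x c J - koszul x e J.
Proof.
elim: J c e => [|j J IH] c e /=; first by rewrite subr0.
by rewrite xB IH !opprD addrACA.
Qed.

Lemma koszul_morph (M M' N N' : zmodType) (f : M -> N) (g : M' -> N')
    (x : I -> M -> M') (y : I -> N -> N') (c : seq I -> M) J :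
  zmod_morphism g -> (forall i v, g (x i v) = y i (f v)) ->
  g (koszul x c J) = koszul y (fun L => f (c L)) J.
Proof.
move=> gB gx; elim: J c => [|j J IH] c /=.
  by rewrite -[X in g X](subrr 0) gB subrr.
by rewrite gB gx IH.
Qed.

(** Expanding along the first index [j] leaves two mixed terms, which cancel because [y j] turns
    [koszul x c] into [koszul y] of [x j] applied to [c]; the rest vanishes by induction. Three
    separate groups allow use on successive graded pieces. *)
Lemma koszul_koszul (M M' M'' : zmodType) (x : I -> M -> M')
    (y : I -> M' -> M'') (c : seq I -> M) J :
  (forall i, zmod_morphism (y i)) ->
  (forall i j v, y i (x j v) = y j (x i v)) ->
  koszul y (koszul x c) J = 0.
Proof.
move=> yB xy; elim: J c => //= j J IH c; rewrite koszulB //.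
by rewrite IH subr0 (@koszul_morph _ _ _ _ (x j) _ _ y) // subrr.
Qed.

End KoszulDifferential.

Section RegularAcyclic.
Variables (K : fieldType) (k : nat).
Local Notation S := {mpoly K[k]}.
Variable M : lmodType S.

Local Notation xop := (fun (i : 'I_k) (v : M) => 'X_i *: v).

(** For a submodule [Q], the vanishing of the Koszul cohomology of M/Q in degrees below [r]. Working
    modulo a predicate avoids forming quotient modules. *)
Definition koszul_acyclic (Q : M -> Prop) (r : nat) : Prop :=
  forall (i : nat) (c : seq 'I_k -> M), (i < r)%N ->
    (forall J, size J = i.+1 -> Q (koszul xop c J)) ->
  exists b, forall J, size J = i -> Q (c J - koszul xop b J).

Lemma xop_zmod_morphism i : zmod_morphism (xop i).
Proof. by move=> u v; rewrite scalerBr. Qed.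

(** Every monomial other than 1 is divisible by a variable. The [g i] serve as weights for the
    contractions below. *)
Lemma mcoeff0_comb (p : S) : p@_0%MM = 0 ->
  exists g : 'I_k -> S, p = \sum_(i < k) g i * 'X_i.
Proof.
move=> p0; have comb (m : 'X_{1..k}) : m != 0%MM ->
    exists g : 'I_k -> S, 'X_[m] = \sum_(i < k) g i * 'X_i.
  move=> m0; have [j mj] : exists j, m j != 0%N.
    apply/existsP; apply: contra_neqT m0 => /existsPn m0.
    by apply/mnmP => j; rewrite mnm0E; apply/eqP; rewrite -[_ == _]negbK m0.
  exists (fun i => if i == j then 'X_[m - U_(j)] else 0).
  rewrite (bigD1 j) //= eqxx big1 => [|i /negPf->]; last by rewrite mul0r.
  by rewrite addr0 -mpolyXD submK // lep1mP.
have /choice[g gP] (m : 'X_{1..k}) : exists g : 'I_k -> S,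
    m != 0%MM -> 'X_[m] = \sum_(i < k) g i * 'X_i.
  have [->|/comb[g ?]] := eqVneq m 0%MM; first by exists (fun=> 0).
  by exists g.
exists (fun i => \sum_(m <- msupp p) p@_m *: g m i).
rewrite {1}(mpolyE p); under [RHS]eq_bigr => i _ do rewrite mulr_suml.
rewrite exchange_big; apply: eq_big_seq => m mp /=.
rewrite gP; last by apply: contraTneq mp => ->; rewrite mcoeff_msupp p0 eqxx.
by rewrite scaler_sumr; apply: eq_bigr => i _; rewrite scalerAl.
Qed.

(* Contraction c |-> c (j :: _) is a homotopy for multiplication by X_j, so an
   element of the irrelevant ideal kills the cohomology of the complex. *)
Lemma koszul_acyclicS (Q Q' : M -> Prop) (f : S) r :
  Q 0 -> (forall u v, Q u -> Q v -> Q (u - v)) ->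
  (forall p v, Q v -> Q (p *: v)) ->
  f@_0%MM = 0 -> (forall v, Q (f *: v) -> Q v) ->
  (forall v, Q' v <-> exists u, Q (v - f *: u)) ->
  koszul_acyclic Q' r -> koszul_acyclic Q r.+1.
Proof.
move=> Q0 QB QZ f0 freg Q'P acyc.
have [g fE] := mcoeff0_comb f0.
have QD u v : Q u -> Q v -> Q (u + v).
  by move=> Qu Qv; rewrite -[v]opprK; apply: (QB) => //; rewrite -sub0r;
    apply: QB.
have Qsum (A : Type) (s : seq A) (F : A -> M) :
    (forall a, Q (F a)) -> Q (\sum_(a <- s) F a).
  by move=> QF; elim/big_rec: _ => // a u _; apply: QD.
have Qkoszul c J : (forall L, (size L).+1 = size J -> Q (c L)) -> Q (koszul xop
  c J).
  elim: J c => //= j J IH c Qc; apply: QB; first by apply/QZ/Qc.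
  by apply: IH => L sL; apply: Qc; rewrite -sL.
move=> i c ilt cQ.
pose sc J := \sum_(j < k) g j *: c (j :: J).
have homotopy J : size J = i -> Q (f *: c J - koszul xop sc J).
  move=> sJ; have -> : koszul xop sc J =
      \sum_(j < k) g j *: koszul xop (fun L => c (j :: L)) J.
    rewrite koszul_sum; last exact: xop_zmod_morphism.
    apply: eq_bigr => j _; apply/esym/(koszul_morph (f := fun v => g j *: v)).
      by move=> u v; rewrite scalerBr.
    by move=> l v; rewrite !scalerA mulrC.
  rewrite fE scaler_suml -sumrB; apply: Qsum => j.
  rewrite -scalerA -scalerBr; apply: QZ; apply: (cQ (j :: J)).
  by rewrite /= sJ.
case: i ilt cQ homotopy => [|i] ilt cQ homotopy.
  exists (fun=> 0) => J sJ; case: J sJ (homotopy J sJ) => //= _.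
  by rewrite !subr0; apply: freg.
(* [Q'] is Q + fM, so [f *: c J] vanishes modulo [Q'] and [sc] is a cocycle there. Writing sc = de +
   fb modulo [Q] and applying d gives f(c - db) in [Q], where [freg] cancels f. *)
have [J sJ|e eP] := acyc i sc ilt.
  apply/Q'P; exists (c J); rewrite -opprB -sub0r; apply: QB => //.
  exact: homotopy.
have /choice[b bP] J : exists u,
    size J = i -> Q (sc J - koszul xop e J - f *: u).
  have [sJ|] := eqVneq (size J) i; last by move=> /eqP ne; exists 0 => /ne.
  by have /Q'P[u Qu] := eP J sJ; exists u.
exists b => J sJ; apply: freg; rewrite scalerBr.
have /Qkoszul : forall L, (size L).+1 = size J ->
    Q (sc L - koszul xop e L - f *: b L) by move=> L; rewrite sJ => -[/bP].
rewrite !koszulB; try exact: xop_zmod_morphism.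
rewrite koszul_koszul; first 1 last.
- exact: xop_zmod_morphism.
- by move=> j l v; rewrite !scalerA mulrC.
have <- : f *: koszul xop b J = koszul xop (fun L => f *: b L) J.
  apply: (koszul_morph (f := fun v => f *: v)).
    by move=> u v; rewrite scalerBr.
  by move=> l v; rewrite !scalerA mulrC.
move=> Qk; rewrite subr0 in Qk.
by have := QD _ _ (homotopy J sJ) Qk; rewrite addrA subrK.
Qed.

Lemma seq_mul0 (rs : seq S) : seq_mul rs (0 : M).
Proof. by exists (fun=> 0); rewrite big1 // => i _; rewrite scaler0. Qed.

Lemma seq_mulB (rs : seq S) (u v : M) :
  seq_mul rs u -> seq_mul rs v -> seq_mul rs (u - v).
Proof.
move=> [a ->] [b ->]; exists (fun i => a i - b i); rewrite -sumrB.
by apply: eq_bigr => i _; rewrite scalerBr.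
Qed.

Lemma seq_mulZ (rs : seq S) p (v : M) : seq_mul rs v -> seq_mul rs (p *: v).
Proof.
move=> [a ->]; exists (fun i => p *: a i); rewrite scaler_sumr.
by apply: eq_bigr => i _; rewrite !scalerA mulrC.
Qed.

Lemma seq_mulP (rs : seq S) (v : M) :
  seq_mul rs v <-> exists u : nat -> M, v = \sum_(i < size rs) rs`_i *: u i.
Proof.
split=> [[u ->]|[u ->]]; last by exists (fun i => u i).
exists (fun i => oapp u 0 (insub i)); apply: eq_bigr => i _.
by rewrite insubT //= => ?; congr (_ *: u _); apply: val_inj.
Qed.

Lemma seq_mul_rcons (rs : seq S) f (v : M) :
  seq_mul (rcons rs f) v <-> exists u, seq_mul rs (v - f *: u).
Proof.
have sumE (u : nat -> M) :
    \sum_(i < size (rcons rs f)) (rcons rs f)`_i *: u i =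
    \sum_(i < size rs) rs`_i *: u i + f *: u (size rs).
  rewrite -(big_mkord xpredT (fun i => (rcons rs f)`_i *: u i)) size_rcons.
  rewrite big_nat_recr //= big_mkord nth_rcons ltnn eqxx; congr (_ + _).
  by apply: eq_bigr => i _; rewrite nth_rcons ltn_ord.
rewrite seq_mulP; split=> [[u ->]|[w /seq_mulP[u /eqP]]].
  by exists (u (size rs)); apply/seq_mulP; exists u; rewrite sumE addrK.
rewrite subr_eq => /eqP ->.
pose u' i := if i == size rs then w else u i.
exists u'; rewrite sumE {2}/u' eqxx.
by congr (_ + _); apply: eq_bigr => i _; rewrite /u' ltn_eqF.
Qed.

Lemma regular_koszul_acyclic (rs : seq S) :
  {in rs, forall p : S, p@_0%MM = 0} -> regular_seq M rs ->
  koszul_acyclic (fun v => v = 0) (size rs).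
Proof.
move=> rs0 [reg _].
(* Modulo all of [rs] the range is empty; dropping the last element of the truncated sequence gains
   one degree. *)
suff acyc r : (r <= size rs)%N ->
    koszul_acyclic (seq_mul (take (size rs - r) rs)) r.
  have := acyc _ (leqnn _); rewrite subnn take0 => ac i c ilt c0.
  have nilP (v : M) : seq_mul [::] v <-> v = 0.
    by split=> [[u ->]|->]; [rewrite big_ord0 | exact: seq_mul0].
  have [J /c0 /nilP//|b bP] := ac i c ilt.
  by exists b => J /bP/nilP.
elim: r => [|r IH] rle; first by move=> i c; rewrite ltn0.
have ilt : (size rs - r.+1 < size rs)%N by rewrite ltn_subrL /= (leq_trans _
  rle).
apply: (koszul_acyclicS (f := rs`_(size rs - r.+1))) (IH (ltnW rle)).
- exact: seq_mul0.
- exact: seq_mulB.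
- exact: seq_mulZ.
- exact/rs0/mem_nth.
- exact: reg.
move=> v; rewrite -seq_mul_rcons -take_nth // -subSn //.
Qed.

End RegularAcyclic.

(** * Graded modules as matrices *)

Section GradedMatrices.
Variables (p : nat).

Definition mxop (K : fieldType) (h : nat -> nat)
    (X : forall d, 'I_p -> 'M[K]_(h d, h d.+1)) d (i : 'I_p) (v : 'rV[K]_(h d))
      :=
  v *m X d i.

Definition mx_commuting (K : fieldType) (h : nat -> nat)
    (X : forall d, 'I_p -> 'M[K]_(h d, h d.+1)) :=
  forall d i j, X d i *m X d.+1 j = X d j *m X d.+1 i.

(** The values of [c] lie in internal degree [d.+1], those of [b] in degree [d]. Cochains in
    internal degree 0 are not tested, so the condition matches acyclicity of the module when [h 0]
    is zero. *)
Definition mx_acyclic (K : fieldType) (h : nat -> nat)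
    (X : forall d, 'I_p -> 'M[K]_(h d, h d.+1)) (r : nat) :=
  forall i d (c : seq 'I_p -> 'rV[K]_(h d.+1)), (i < r)%N ->
    (forall J, size J = i.+1 -> koszul (mxop X (d := d.+1)) c J = 0) ->
  exists b, forall J, size J = i -> c J = koszul (mxop X (d := d)) b J.

Lemma mxop_zmod_morphism (K : fieldType) h
    (X : forall d, 'I_p -> 'M[K]_(h d, h d.+1)) d i :
  zmod_morphism (mxop X (d := d) i).
Proof. by move=> u v; rewrite /mxop mulmxBl. Qed.

Lemma mxop_comm (K : fieldType) h (X : forall d, 'I_p -> 'M[K]_(h d, h d.+1)) :
  mx_commuting X -> forall d i j v,
  mxop X i (mxop X j v) = mxop X j (mxop X (d := d) i v).
Proof. by move=> Xc d i j v; rewrite /mxop -!mulmxA Xc. Qed.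

Section Quotient.
Variables (K : fieldType) (h : nat -> nat).
Variables (X : forall d, 'I_p -> 'M[K]_(h d, h d.+1)) (a : 'I_p -> K).
Hypothesis Xc : mx_commuting X.

Let l d := \sum_(i < p) a i *: X d i.
Hypothesis l_inj : forall d (u : 'rV_(h d)), u *m l d = 0 -> u = 0.

(** Dimensions of the quotient by the linear form [l]. Since [cokermx] is a square matrix, its
    column base is taken as the projection, onto a space of the exact dimension. Degree 0 contains
    no multiples of [l]. *)
Definition qdim d := if d is e.+1 then \rank (cokermx (l e)) else h 0.

Definition qproj d : 'M[K]_(h d, qdim d) :=
  if d is e.+1 then col_base (cokermx (l e)) else 1%:M.

(** [pinvmx (qproj d)] is a linear section of the projection: lift, multiply, project. *)
Definition qmx d (i : 'I_p) : 'M[K]_(qdim d, qdim d.+1) :=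
  pinvmx (qproj d) *m X d i *m qproj d.+1.

Lemma qproj_full d : row_full (qproj d).
Proof. by case: d => [|d];
  [rewrite row_full_unit unitmx1 | exact: col_base_full]. Qed.

Lemma lX d i : l d *m X d.+1 i = X d i *m l d.+1.
Proof.
rewrite /l mulmx_suml mulmx_sumr; apply: eq_bigr => j _.
by rewrite -scalemxAl -scalemxAr Xc.
Qed.

Lemma qproj_ker d m (A : 'M_(m, h d.+1)) :
  A *m qproj d.+1 = 0 -> exists B, A = B *m l d.
Proof.
move=> A0; apply/submxP; rewrite submxE.
by rewrite -(mulmx_base (cokermx (l d))) mulmxA A0 mul0mx.
Qed.

Lemma l_qproj d : l d *m qproj d.+1 = 0.
Proof.
apply: (row_free_inj (row_base_free (cokermx (l d)))).
by rewrite -mulmxA mulmx_base mulmx_coker mul0mx.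
Qed.

(** Projecting and lifting changes a vector by an element of the image of [l], and by [lX] the
    variables preserve these images. *)
Lemma qproj_qmx d i : qproj d *m qmx d i = X d i *m qproj d.+1.
Proof.
suff : (qproj d *m pinvmx (qproj d) - 1%:M) *m (X d i *m qproj d.+1) = 0.
  by rewrite mulmxBl mul1mx /qmx !mulmxA => /eqP; rewrite subr_eq0 => /eqP.
have : (qproj d *m pinvmx (qproj d) - 1%:M) *m qproj d = 0.
  by rewrite mulmxBl -mulmxA mulVpmx ?qproj_full // mulmx1 mul1mx subrr.
case: d => [|d].
  by rewrite [X in _ *m X = _ -> _]/= [LHS]mulmx1 => ->; rewrite mul0mx.
move=> /qproj_ker[B ->].
by rewrite -mulmxA (mulmxA (l d)) lX -mulmxA l_qproj !mulmx0.
Qed.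

Lemma qmx_commuting : mx_commuting qmx.
Proof.
move=> d i j; suff E i' j' : qmx d i' *m qmx d.+1 j' =
    pinvmx (qproj d) *m (X d i' *m X d.+1 j') *m qproj d.+2 by rewrite !E Xc.
rewrite [qmx d i']/qmx -(mulmxA (_ *m X d i')) qproj_qmx.
by rewrite (mulmxA _ (X d.+1 j')) -(mulmxA (pinvmx _)).
Qed.

(** The long exact sequence of multiplication by [l], chased on cochains. A cocycle [c] lifts to
    [c1], whose differential is [b] times [l]; injectivity of [l] makes [b] a cocycle, say the
    differential of [e]. Then [c1] minus [e] times [l] is a cocycle, and its primitive [f] projects
    to a primitive of [c]. The use of degree i + 1 costs one step of the range. *)
Lemma qmx_acyclic r : mx_acyclic X r.+1 -> mx_acyclic qmx r.
Proof.
move=> ac i d c ilt c0.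
pose c1 J := c J *m pinvmx (qproj d.+1).
have c1K J : c1 J *m qproj d.+1 = c J.
  by rewrite /c1 -mulmxA mulVpmx ?qproj_full // mulmx1.
have mulB e m (A : 'M_(h e, m)) : zmod_morphism (fun v : 'rV_(h e) => v *m A).
  by move=> u v; rewrite mulmxBl.
have projk e (b : seq 'I_p -> 'rV_(h e)) J :
    koszul (mxop X (d := e)) b J *m qproj e.+1 =
    koszul (mxop qmx (d := e)) (fun L => b L *m qproj e) J.
  apply: (koszul_morph (f := fun v => v *m qproj e) (g := fun v => v *m qproj
    e.+1)); first exact: mulB.
  by move=> j v; rewrite /mxop -!mulmxA qproj_qmx.
have lk e (b : seq 'I_p -> 'rV_(h e)) J :
    koszul (mxop X (d := e)) b J *m l e.+1 =
    koszul (mxop X (d := e.+1)) (fun L => b L *m l e) J.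
  apply: (koszul_morph (f := fun v => v *m l e) (g := fun v => v *m l e.+1));
    first exact: mulB.
  by move=> j v; rewrite /mxop -!mulmxA lX.
have /choice[b bP] J : exists b, size J = i.+1 ->
    koszul (mxop X (d := d.+1)) c1 J = b *m l d.+1.
  have [sJ|/eqP ne] := eqVneq (size J) i.+1; last by exists 0 => /ne.
  have [|b ->] := @qproj_ker d.+1 1 (koszul (mxop X (d := d.+1)) c1 J).
    by rewrite projk -[RHS](c0 J sJ); apply: eq_koszul.
  by exists b.
have [J sJ|e eP] := ac i.+1 d b ilt.
  apply: l_inj; rewrite lk.
  rewrite (@eq_koszul _ _ _ _ (mxop X (d := d.+2)) _ (koszul (mxop X (d :=
    d.+1)) c1)) //.
    by apply: koszul_koszul; [exact: mxop_zmod_morphism | exact: mxop_comm].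
  by move=> L; rewrite sJ => -[/bP].
pose c2 J := c1 J - e J *m l d.
have [J sJ|f fP] := ac i d c2 (ltnW ilt).
  rewrite koszulB; last exact: mxop_zmod_morphism.
  by rewrite -lk bP // eP // subrr.
exists (fun J => f J *m qproj d) => J sJ.
by rewrite -projk -fP // /c2 mulmxBl -(mulmxA (e J)) l_qproj mulmx0 subr0 c1K.
Qed.

Lemma qdimS d : (qdim d.+1 + h d)%N = h d.+1.
Proof.
have lrank : \rank (l d) = h d.
  apply/eqP; rewrite -[_ == _]/(row_free (l d)) -kermx_eq0.
  apply/eqP/row_matrixP => i; rewrite row0.
  by apply: l_inj; rewrite -row_mul mulmx_ker row0.
have := rank_leq_col (l d); rewrite /= mxrank_coker lrank; exact: subnK.
Qed.

End Quotient.

End GradedMatrices.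

(** * Base change to the field of rational functions *)

Local Notation "x %:F" := (@FracField.tofrac _ x).

Lemma fracE (D : idomainType) (x : {fraction D}) :
  exists2 nd : D * D, nd.2 != 0 & nd.2%:F * x = nd.1%:F.
Proof.
elim/quotW: x => r; exists (frac r); first exact: denom_ratioP.
rewrite /= /FracField.tofrac; unlock; rewrite -[LHS]FracField.pi_mul.
apply/eqmodP; rewrite /= FracField.equivfE /FracField.mulf.
have d0 := denom_ratioP r; rewrite !numden_Ratio ?oner_eq0 ?mul1r //.
by rewrite mulr1 mulrC.
Qed.

Lemma frac_common_den (D : idomainType) (T : finType) (f : T -> {fraction D}) :
  exists2 q : D, q != 0 & exists g : T -> D, forall t, q%:F * f t = (g t)%:F.
Proof.
have /choice[nd ndP] t : exists nd : D * D,
  nd.2 != 0 /\ nd.2%:F * f t = nd.1%:F by have [nd] := fracE (f t); exists nd.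
exists (\prod_t (nd t).2).
  by apply/prodf_neq0 => t _; have [] := ndP t.
exists (fun t => (nd t).1 * \prod_(s | s != t) (nd s).2) => t.
by rewrite (bigD1 t) //= rmorphM mulrAC (ndP t).2 -rmorphM.
Qed.

Section BaseChange.
Variables (p : nat) (K : fieldType) (h : nat -> nat).
Variable X : forall d, 'I_p -> 'M[K]_(h d, h d.+1).
Hypothesis Xc : mx_commuting X.

Local Notation L := {fraction {poly K}}.
Local Notation tofracK := (@FracField.tofrac {poly K}).
Local Notation iota := (tofracK \o polyC).

Definition ext_mx d (i : 'I_p) : 'M[L]_(h d, h d.+1) := map_mx iota (X d i).

Lemma ext_mx_commuting : mx_commuting ext_mx.
Proof. by move=> d i j; rewrite /ext_mx -!map_mxM Xc. Qed.

(* McCoy's theorem for the polynomial X_0 + X_1 a + ... acting on the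
   polynomials in a with coefficients in the module: u stands for
   u 0 + u 1 a + ..., of degree less than T. *)
Lemma mccoy (socle0 : forall d (v : 'rV[K]_(h d)),
    (forall i, v *m X d i = 0) -> v = 0) T d (u : nat -> 'rV[K]_(h d)) :
  (forall k, (T <= k)%N -> u k = 0) ->
  (forall k, \sum_(i < p) (if (k < i)%N then 0 else u (k - i)%N *m X d i) = 0)
    ->
  forall k, u k = 0.
Proof.
elim: T d u => [|T IH] d u uT fu k; first exact: uT.
suff uX i k' : u k' *m X d i = 0 by apply: socle0.
(* Downward induction on [i]. In the coefficient of a^(T+i), terms with j > i vanish by this
   induction and terms with j < i because their index exceeds [T]. Hence [u T *m X d i] is zero, and
   the outer induction applies to [u k *m X d i]. *)
have [n ltn] := ubnP (p - i)%N; elim: n => // n IHn in i ltn k' *.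
apply: (IH _ (fun k => u k *m X d i)) => {k'} [k' Tk|k'].
  have [->|neT] := eqVneq k' T; last first.
    by rewrite uT ?mul0mx // ltn_neqAle eq_sym neT.
  rewrite -[RHS](fu (T + i)%N) (bigD1 i) //= ltnNge leq_addl /= addnK.
  rewrite big1 ?addr0 // => j ji; case: ifP => // /negbT; rewrite -leqNgt => jT.
  have [ij|ij|/val_inj eij] := ltngtP i j; last by rewrite eij eqxx in ji.
    by apply: IHn; rewrite (leq_trans _ (ltn : (_ <= n)%N)) // ltn_sub2l.
  by rewrite uT ?mul0mx // ltn_subRL addnC ltn_add2l.
rewrite -[RHS](mul0mx _ (X d.+1 i)) -(fu k') mulmx_suml.
apply: eq_bigr => j _; case: ifP => // _; first by rewrite mul0mx.
by rewrite -!mulmxA Xc.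
Qed.

Lemma row_common_den n (u : 'rV[L]_n) :
  exists2 q : {poly K}, q != 0 & exists U, q%:F *: u = map_mx tofracK U.
Proof.
have [q q0 [g gP]] := frac_common_den (fun j => u 0 j).
exists q => //; exists (\row_j g j).
by apply/rowP => j; rewrite !mxE gP.
Qed.

Lemma map_tofrac_inj m n : injective (map_mx tofracK : 'M_(m, n) -> _).
Proof.
move=> A B AB; apply/matrixP => i j.
by have /matrixP/(_ i j) := AB; rewrite !mxE => /eqP; rewrite tofrac_eq => /eqP.
Qed.

Definition generic_coef (i : 'I_p) : L := 'X^i%:F.

(** After clearing denominators [u] is a row of polynomials in a, and its coefficient rows [uk k]
    satisfy the convolution equations of [mccoy]. *)
Lemma generic_inj (socle0 : forall d (v : 'rV[K]_(h d)),
    (forall i, v *m X d i = 0) -> v = 0) d (u : 'rV[L]_(h d)) :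
  u *m (\sum_(i < p) generic_coef i *: ext_mx d i) = 0 -> u = 0.
Proof.
move=> fu; have [q q0 [U UE]] := row_common_den u.
suff U0 : U = 0.
  apply/eqP; move/eqP: UE; rewrite U0 map_mx0 scaler_eq0.
  by rewrite tofrac_eq0 (negPf q0).
have {}fu : U *m (\sum_(i < p) 'X^i *: map_mx polyC (X d i)) = 0.
  apply: map_tofrac_inj; rewrite map_mxM map_mx0 -UE -scalemxAl.
  rewrite raddf_sum /= -[RHS](scaler0 _ q%:F) -fu; congr (_ *: (_ *m _)).
  by apply: eq_bigr => i _; rewrite map_mxZ /ext_mx map_mx_comp.
pose uk k : 'rV[K]_(h d) := \row_j (U 0 j)`_k.
suff uk0 k : uk k = 0.
  apply/rowP => j; rewrite mxE; apply/polyP => k.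
  by have /rowP/(_ j) := uk0 k; rewrite !mxE coef0.
apply: (mccoy socle0 (T := \max_j size (U 0%R j)) (u := uk)) => {}k.
  move=> kT; apply/rowP => j; rewrite !mxE nth_default //.
  by apply: leq_trans kT;
    apply: (leq_bigmax_cond (F := fun j => size (U 0%R j))).
apply/rowP => j; rewrite [RHS]mxE.
have <- : ((U *m \sum_(i < p) 'X^i *: map_mx polyC (X d i)) 0 j)`_k = 0.
  by rewrite fu mxE coef0.
rewrite mulmx_sumr !summxE coef_sum.
apply: eq_bigr => i _; rewrite -scalemxAr mxE coefXnM.
case: ifP => _; first by rewrite mxE.
rewrite !mxE coef_sum; apply: eq_bigr => a _.
by rewrite !mxE coefMC.
Qed.

(** Exactness survives the extension from K to K(a). Only finitely many lists have size [i], so a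
    single [q] clears all denominators of [c]; the coefficients of each a^k then form a cocycle over
    K, and the primitives obtained over K are recombined. *)
Lemma ext_mx_acyclic r : mx_acyclic X r -> mx_acyclic ext_mx r.
Proof.
move=> ac i d c ilt c0.
have [q q0 [g gP]] := frac_common_den
  (fun t : i.-tuple 'I_p * 'I_(h d.+1) => c t.1 0 t.2).
pose C J : 'rV[{poly K}]_(h d.+1) :=
  \row_j (if insub J is Some t then g (t, j) else 0).
have CE J : size J = i -> map_mx tofracK (C J) = q%:F *: c J.
  move=> sJ; apply/rowP => j; rewrite !mxE insubT ?sJ //= => sJ'.
  by rewrite -gP.
pose PX e := fun (i : 'I_p) (v : 'rV[{poly K}]_(h e)) => v *m map_mx polyC (X e
  i).
have mapB (R R' : nzRingType) (f : {rmorphism R -> R'}) m n :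
  zmod_morphism (map_mx f : 'M_(m, n) -> _) by move=> A B; rewrite map_mxB.
have C0 J : size J = i.+1 -> koszul (PX d.+1) C J = 0.
  move=> sJ; apply: map_tofrac_inj; rewrite map_mx0.
  rewrite (koszul_morph (f := map_mx tofracK) (y := mxop ext_mx (d := d.+1)));
    first 1 last.
  - exact: mapB.
  - by move=> j v; rewrite /mxop /PX map_mxM /ext_mx map_mx_comp.
  rewrite -[RHS](scaler0 _ q%:F) -(c0 J sJ).
  rewrite (koszul_morph (f := fun v => q%:F *: v) (g := fun v => q%:F *: v)
    (y := mxop ext_mx (d := d.+1))); first 1 last.
  - by move=> u v; rewrite scalerBr.
  - by move=> j v; rewrite /mxop scalemxAl.
  by apply: eq_koszul => // M; rewrite sJ => -[/CE].
pose ck k J : 'rV[K]_(h d.+1) := \row_j (C J 0 j)`_k.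
have /choice[b bP] k : exists b, forall J, size J = i ->
    ck k J = koszul (mxop X (d := d)) b J.
  apply: (ac i d (ck k) ilt) => J sJ.
  pose f m (v : 'rV[{poly K}]_m) : 'rV[K]_m := \row_j (v 0 j)`_k.
  have <- : f _ (koszul (PX d.+1) C J) = koszul (mxop X (d := d.+1)) (ck k) J.
    apply: (koszul_morph (f := @f (h d.+1))) => [u v|j v].
      by apply/rowP => j; rewrite !mxE coefB.
    apply/rowP => l; rewrite !mxE coef_sum; apply: eq_bigr => a _.
    by rewrite !mxE coefMC.
  by rewrite C0 //; apply/rowP => j; rewrite !mxE coef0.
pose N := \max_(t : i.-tuple 'I_p) \max_j size (C t 0%R j).
exists (fun J => \sum_(k < N) (q%:F^-1 * 'X^k%:F) *: map_mx iota (b k J)).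
move=> J sJ.
rewrite koszul_sum; last exact: mxop_zmod_morphism.
have cE : c J = q%:F^-1 *: map_mx tofracK (C J).
  by rewrite CE // scalerA mulVf ?scale1r // tofrac_eq0.
rewrite cE; have -> : C J = \sum_(k < N) 'X^k *: map_mx polyC (ck k J).
  apply/rowP => j; rewrite summxE;
    under eq_bigr => k _ do rewrite 3!mxE mulrC mul_polyC.
  rewrite -poly_def; apply/polyP => l; rewrite coef_poly; case: ltnP => // Nl.
  apply: nth_default; apply: leq_trans Nl; move: (sJ) => /eqP sJ'.
  have := @leq_bigmax _ (fun t : i.-tuple 'I_p => \max_j size (C t 0%R j))
    (Tuple sJ').
  by apply: leq_trans; exact: (@leq_bigmax _ (fun j => size (C J 0%R j))).
rewrite raddf_sum scaler_sumr; apply: eq_bigr => k _ /=.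
rewrite map_mxZ scalerA -map_mx_comp bP //.
pose g' m (v : 'rV[K]_m) : 'rV[L]_m := (q%:F^-1 * 'X^k%:F) *: map_mx iota v.
apply: (koszul_morph (f := @g' (h d)) (g := @g' (h d.+1))) => [u v|j v].
  by rewrite /g' map_mxB scalerBr.
by rewrite /mxop /g' map_mxM scalemxAl.
Qed.

End BaseChange.

(** * Positivity of differences of the Hilbert function *)

(* Coefficients of (1 - z) * f. *)
Definition diff (f : nat -> int) (d : nat) : int :=
  if d is e.+1 then f d - f e else f 0%N.

(* Index d stands for module degree d - 1, whence the hypothesis on h 0. *)
Lemma acyclic_diff_ge0 p (K : fieldType) (h : nat -> nat)
    (X : forall d, 'I_p -> 'M[K]_(h d, h d.+1)) r :
  h 0%N = 0%N -> mx_commuting X -> mx_acyclic X r ->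
  forall d, 0 <= iter r diff (fun e => (h e)%:Z) d.
Proof.
(* The field is generalized, since each step passes from K to K(a). *)
elim: r K h X => [//|r IH] K h X h0 Xc ac d.
(* Vanishing of the cohomology in degree 0 says that no nonzero element is killed by all
   variables. *)
have socle0 e (v : 'rV[K]_(h e)) : (forall i, v *m X e i = 0) -> v = 0.
  case: e v => [|e] v vX; first by apply/rowP => -[j jlt]; exfalso;
    rewrite h0 in jlt.
  have [|b /(_ [::] erefl)//] := ac 0%N e (fun=> v) isT.
  by move=> [|j []] //= _; rewrite /mxop vX subr0.
have l_inj := generic_inj Xc socle0.
have := IH _ _ _ _ (qmx_commuting (@generic_coef p K) (ext_mx_commuting Xc))
  (qmx_acyclic (ext_mx_commuting Xc) l_inj (ext_mx_acyclic ac)).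
rewrite iterSr; set h' := qdim _ _ => IHq.
suff -> : diff (fun e => (h e)%:Z) = fun e => (h' e)%:Z by apply: IHq.
apply: funext => -[|e] //; rewrite [LHS]/=.
by have : (h' e.+1 + h e = h e.+1)%N := qdimS l_inj e; lia.
Qed.

(** * From graded modules to matrices *)

Section GradedToMatrices.
Variables (K : fieldType) (k : nat) (N : gradedModule K k).
Local Notation S := {mpoly K[k]}.

Lemma gcompD d (u v : N) : gcomp d u -> gcomp d v -> gcomp d (u + v).
Proof.
move=> hu hv; rewrite -[v]opprK; apply: gcompB => //; rewrite -sub0r.
by apply: gcompB => //; apply: gcomp0.
Qed.

Lemma gcomp_big d (A : Type) (s : seq A) (P : pred A) (F : A -> N) :
  (forall a, P a -> gcomp d (F a)) -> gcomp d (\sum_(a <- s | P a) F a).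
Proof. by move=> hF; elim/big_ind: _ => //; [exact: gcomp0 | move=> *;
  exact: gcompD]. Qed.

Lemma gcompZC d (c : K) (v : N) : gcomp d v -> gcomp d (c%:MP *: v).
Proof.
move=> hv; rewrite -[d]add0r -[0]/(0%N%:Z); apply: gcompZ => //.
by apply/dhomogP => m /=; rewrite msuppC; case: ifP => // _;
  rewrite inE => /eqP->; rewrite mdeg0.
Qed.

Lemma gcompX d (i : 'I_k) (v : N) : gcomp d v -> gcomp (1 + d) ('X_i *: v).
Proof. by move=> hv; apply: (gcompZ (e := 1%N)) => //;
  rewrite dhomogX /= mdeg1. Qed.

Lemma eq_sum_support (ds ds' : seq int) (u : int -> N) :
  uniq ds -> uniq ds' -> {subset ds <= ds'} -> (forall d, d \notin ds -> u d =
    0) ->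
  \sum_(d <- ds) u d = \sum_(d <- ds') u d.
Proof.
move=> dsU ds'U sub u0; rewrite [RHS](bigID (mem ds)) /=.
rewrite [X in _ + X]big1 ?addr0 // -[RHS]big_filter; apply: perm_big.
apply: uniq_perm; rewrite ?filter_uniq // => d; rewrite mem_filter.
by have [/sub->|] := boolP (d \in ds).
Qed.

Lemma gcomp_decomp (v : N) : exists (ds : seq int) (u : int -> N),
  [/\ uniq ds, forall d, gcomp d (u d), forall d, d \notin ds -> u d = 0
    & v = \sum_(d <- ds) u d].
Proof.
have [ds [u [dsU hu vE]]] := gcomp_sum v.
exists ds, (fun d => if d \in ds then u d else 0); split => //.
- by move=> d; case: ifP => // _; apply: gcomp0.
- by move=> d /negPf->.
- by rewrite vE; apply: eq_big_seq => d ->.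
Qed.

(** Directness makes the components of an element independent of the chosen decomposition, hence
    additive and compatible with the variables. They cut an inhomogeneous primitive cochain down to
    one degree. *)
Lemma gproj_ex : exists pr : int -> N -> N,
  [/\ forall d, zmod_morphism (pr d), forall d v, gcomp d (pr d v),
      forall d v, gcomp d v -> pr d v = v
    & forall d i v, pr (1 + d) ('X_i *: v) = 'X_i *: pr d v].
Proof.
pose dec (v : N) (dsu : seq int * (int -> N)) :=
  [/\ uniq dsu.1, forall d, gcomp d (dsu.2 d),
      forall d, d \notin dsu.1 -> dsu.2 d = 0 & v = \sum_(d <- dsu.1) dsu.2 d].
have /choice[w wP] v : exists dsu, dec v dsu.
  by have [ds [u uP]] := gcomp_decomp v; exists (ds, u).
have decW v ds u (ds' : seq int) : dec v (ds, u) -> uniq ds' -> {subset ds <=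
  ds'} ->
    v = \sum_(d <- ds') u d.
  by move=> [/= dsU _ u0 ->] ds'U sub; apply: eq_sum_support.
have dec_uniq v ds u ds' u' : dec v (ds, u) -> dec v (ds', u') -> u =1 u'.
  move=> D1 D2; pose s := undup (ds ++ ds').
  have sU : uniq s by apply: undup_uniq.
  have e1 : v = \sum_(d <- s) u d.
    by apply: decW D1 sU _ => d; rewrite mem_undup mem_cat => ->.
  have e2 : v = \sum_(d <- s) u' d.
    by apply: decW D2 sU _ => d; rewrite mem_undup mem_cat orbC => ->.
  move=> d; have [ds1|] := boolP (d \in s).
    apply/eqP; rewrite -subr_eq0; apply/eqP.
    apply: (@gcomp_direct _ _ N s (fun d => u d - u' d)) => //.
      by move=> e; apply: gcompB; [case: D1 | case: D2].
    by rewrite sumrB -e1 -e2 subrr.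
  rewrite mem_undup mem_cat negb_or => /andP[d1 d2].
  by have [_ _ /= -> // _] := D1; have [_ _ /= -> // _] := D2.
exists (fun d v => (w v).2 d).
have wdec v : dec v ((w v).1, (w v).2) by rewrite -surjective_pairing.
split.
- move=> d u v; pose s := undup ((w u).1 ++ (w v).1).
  apply: (dec_uniq (u - v) _ _ s (fun d => (w u).2 d - (w v).2 d)) => //.
  split=> /=; first exact: undup_uniq.
  + by move=> e; apply: gcompB; [case: (wP u) | case: (wP v)].
  + move=> e; rewrite mem_undup mem_cat negb_or => /andP[d1 d2].
    by have [_ _ -> // _] := wP u; have [_ _ -> // _] := wP v; rewrite subrr.
  + rewrite sumrB -(decW _ _ _ s (wdec u)) ?undup_uniq //; last first.
      by move=> e; rewrite mem_undup mem_cat => ->.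
    rewrite -(decW _ _ _ s (wdec v)) ?undup_uniq //.
    by move=> e; rewrite mem_undup mem_cat orbC => ->.
- by move=> d v; case: (wP v).
- move=> d v hv; pose u := fun e => if e == d then v else 0.
  rewrite -[RHS](_ : u d = v); last by rewrite /u eqxx.
  apply: (dec_uniq v _ _ [:: d] u) => //; split=> //=.
  + by move=> e; rewrite /u; case: eqP => [->//|_]; apply: gcomp0.
  + by move=> e; rewrite inE /u => /negPf->.
  + by rewrite big_seq1 /u eqxx.
- move=> d i v.
  pose u e := 'X_i *: (w v).2 (e - 1).
  have -> : 'X_i *: (w v).2 d = u (1 + d) by rewrite /u addrAC subrr add0r.
  apply: (dec_uniq ('X_i *: v) _ _ [seq 1 + e | e <- (w v).1] u) => //.
  have [wU wg w0 wE] := wP v; split=> //=.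
  + by rewrite map_inj_uniq //; apply: addrI.
  + by move=> e; rewrite -[e](subrK 1) addrC /u addrAC subrr add0r;
    apply: gcompX.
  + move=> e enot; rewrite /u w0 ?scaler0 //; apply: contraNN enot => ew.
    by apply/mapP; exists (e - 1) => //; rewrite addrC subrK.
  + rewrite big_map /u {1}wE scaler_sumr; apply: eq_bigr => e _.
    by rewrite addrAC subrr add0r.
Qed.

(** Bases of the graded pieces turn the variables into matrices, which inherit the Koszul vanishing.
    Degrees start at -1, where the piece is zero. *)
Lemma regular_seq_shift_diff_ge0 (H : int -> nat) (rs : seq S) :
  hilbert_series N H -> H (-1) = 0%N ->
  {in rs, forall q : S, q@_0%MM = 0} -> regular_seq N rs ->
  forall d, 0 <= iter (size rs) diff (fun e => (H (e%:Z - 1))%:Z) d.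
Proof.
move=> HN H0 rs0 reg; pose deg d : int := d%:Z - 1; pose h d := H (deg d).
have degS d : deg d.+1 = 1 + deg d by rewrite /deg; lia.
pose e d : 'I_(h d) -> N := projT1 (cid (HN (deg d))).
have eP d := projT2 (cid (HN (deg d))).
pose phi d (v : 'rV[K]_(h d)) : N := \sum_(i < h d) (v 0 i)%:MP *: e d i.
have phiB d : zmod_morphism (@phi d).
  move=> u v; rewrite /phi -sumrB; apply: eq_bigr => i _.
  by rewrite !mxE mpolyCB scalerBl.
have phiI d (v : 'rV_(h d)) : phi d v = 0 -> v = 0.
  have [_ efree _] := eP d.
  by move=> /efree v0; apply/rowP => i; rewrite mxE.
have phi_inj d : injective (@phi d).
  by move=> u v /eqP; rewrite -subr_eq0 -phiB => /eqP/phiI/eqP;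
    rewrite subr_eq0 => /eqP.
have phi_comp d v : gcomp (deg d) (phi d v).
  by have [he _ _] := eP d; apply: gcomp_big => i _; apply/gcompZC/he.
have phi_onto d v : gcomp (deg d) v -> exists w, v = phi d w.
  have [_ _ egen] := eP d => /egen[c ->]; exists (\row_i c i).
  by apply: eq_bigr => i _; rewrite mxE.
have phi0 d : phi d 0 = 0 by rewrite -(subrr 0) phiB subrr.
have wex d : exists w : 'I_k -> 'I_(h d) -> 'rV_(h d.+1),
    forall i j, 'X_i *: e d j = phi d.+1 (w i j).
  have /choice[w wP] (ij : 'I_k * 'I_(h d)) : exists w,
      'X_(ij.1) *: e d ij.2 = phi d.+1 w.
    apply: phi_onto; rewrite degS; apply: gcompX.
    by have [he _ _] := eP d; apply: he.
  by exists (fun i j => w (i, j)) => i j; rewrite (wP (i, j)).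
pose X d i : 'M_(h d, h d.+1) := \matrix_j projT1 (cid (wex d)) i j.
have phiX d i (v : 'rV_(h d)) : phi d.+1 (v *m X d i) = 'X_i *: phi d v.
  have phiD (u u' : 'rV_(h d.+1)) : phi d.+1 (u + u') = phi d.+1 u + phi d.+1
    u'.
    by rewrite -[u' in LHS]opprK phiB -[- u' in LHS]sub0r phiB phi0 sub0r opprK.
  rewrite mulmx_sum_row (big_morph _ phiD (phi0 _)) scaler_sumr.
  apply: eq_bigr => j _; rewrite rowK scalerA mulrC -scalerA.
  rewrite (projT2 (cid (wex d))) /phi scaler_sumr; apply: eq_bigr => l _.
  by rewrite mxE mpolyCM scalerA.
have Xc : mx_commuting X.
  move=> d i j; apply/row_matrixP => l; rewrite !rowE; apply: phi_inj.
  by rewrite !mulmxA !phiX !scalerA mulrC.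
apply: acyclic_diff_ge0 (Xc) _ => // i d c ilt c0.
pose xop := fun (i : 'I_k) (v : N) => 'X_i *: v.
have phik a (b : seq 'I_k -> 'rV_(h a)) J : phi a.+1 (koszul (mxop X (d := a))
  b J) =
    koszul xop (fun L => phi a (b L)) J.
  by apply: koszul_morph; [exact: phiB | move=> j v; rewrite /mxop phiX].
have [J sJ|b bP] := regular_koszul_acyclic rs0 reg (c := fun J => phi d.+1 (c
  J)) ilt.
  by rewrite -phik c0.
(* The values of [b] need not be homogeneous. Their components of degree [deg d] still give a
   primitive, as the variables have degree 1 and the cochain [phi d.+1 (c J)] is homogeneous. *)
have [pr [prB pr_comp pr_id prX]] := gproj_ex.
have /choice[b' b'P] J : exists w, pr (deg d) (b J) = phi d w by apply:
  phi_onto.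
exists b' => J sJ; apply: phi_inj; rewrite phik.
rewrite -(pr_id (deg d.+1) (phi d.+1 (c J))) //.
have /eqP := bP J sJ; rewrite subr_eq0 => /eqP ->; rewrite degS.
rewrite (koszul_morph (f := pr (deg d)) (y := xop)) //.
by apply: eq_koszul.
Qed.

Lemma diff_shift (f : nat -> int) : f 0%N = 0 ->
  forall r d, iter r diff f d.+1 = iter r diff (fun e => f e.+1) d /\
              iter r diff f 0%N = 0.
Proof.
move=> f0; elim=> // r IH d; split; last by rewrite /= (IH 0%N).2.
by case: d => [|d];
  rewrite /= ?(IH 0%N).1 ?(IH 0%N).2 ?(IH d.+1).1 ?(IH d).1 // subr0.
Qed.

Lemma regular_seq_diff_ge0 (H : int -> nat) (rs : seq S) :
  hilbert_series N H -> H (-1) = 0%N ->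
  {in rs, forall q : S, q@_0%MM = 0} -> regular_seq N rs ->
  forall d, 0 <= iter (size rs) diff (fun e => (H e)%:Z) d.
Proof.
move=> HN H0 rs0 reg d; have := regular_seq_shift_diff_ge0 HN H0 rs0 reg d.+1.
rewrite (diff_shift _ _ _).1 ?H0 //; congr (0 <= iter _ _ _ _).
by apply: funext => e; congr (H _)%:Z; lia.
Qed.

End GradedToMatrices.

(** * Hilbert series of polynomial rings *)

Section Dimension.
Variables (K : fieldType) (k : nat).
Local Notation S := {mpoly K[k]}.

Lemma has_dim_seq (M : lmodType S) (V : M -> Prop) (T : eqType) (s : seq T)
    (e : T -> M) :
  uniq s -> {in s, forall t, V (e t)} ->
  (forall c : T -> K, \sum_(t <- s) (c t)%:MP *: e t = 0 -> {in s, forall t, c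
    t = 0}) ->
  (forall v, V v -> exists c : T -> K, v = \sum_(t <- s) (c t)%:MP *: e t) ->
  has_dim V (size s).
Proof.
move=> sU Ve efree egen; exists (fun i => e (tnth (in_tuple s) i)).
split=> [i|c c0 i|v /egen[c ->]].
- by apply: Ve; exact: mem_tnth.
- pose c' t := oapp c 0 (insub (index t s)).
  have c'E j : c' (tnth (in_tuple s) j) = c j.
    rewrite /c' (tnth_nth (tnth (in_tuple s) j)) /= index_uniq // insubT //= =>
      ?.
    by congr c; apply: val_inj.
  rewrite -c'E; suff c'0 : {in s, forall t, c' t = 0} by apply: c'0;
    exact: mem_tnth.
  apply: efree.
  by rewrite big_tnth -[RHS]c0; apply: eq_bigr => j _; rewrite c'E.
- by exists (fun i => c (tnth (in_tuple s) i)); rewrite big_tnth.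
Qed.

(** A left kernel vector of the coordinate matrix [A] would be a linear relation among the [e1 i],
    so [A] has rank [r1]. *)
Lemma has_dim_leq (M : lmodType S) (V : M -> Prop) r1 r2 :
  has_dim V r1 -> has_dim V r2 -> (r1 <= r2)%N.
Proof.
move=> [e1 [V1 free1 _]] [e2 [_ _ gen2]].
have /choice[a aP] i : exists c : 'I_r2 -> K,
    e1 i = \sum_(j < r2) (c j)%:MP *: e2 j by exact: gen2.
pose A : 'M[K]_(r1, r2) := \matrix_(i, j) a i j.
suff <- : \rank A = r1 by apply: rank_leq_col.
apply/eqP; rewrite -[_ == _]/(row_free A) -kermx_eq0;
  apply/eqP/row_matrixP => l.
have : row l (kermx A) *m A = 0 by rewrite -row_mul mulmx_ker row0.
rewrite row0; move: (row l _) => u uA; apply/rowP => i; rewrite mxE.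
apply: (free1 (fun i => u 0 i)).
under eq_bigr => i' _ do rewrite aP scaler_sumr.
rewrite exchange_big big1 //= => j _.
under eq_bigr => i' _ do rewrite scalerA -mpolyCM.
rewrite -scaler_suml -raddf_sum /=.
have /rowP/(_ j) := uA; rewrite !mxE => uA0.
suff -> : \sum_(i' < r1) u 0 i' * a i' j = 0 by rewrite scale0r.
by rewrite -[RHS]uA0; apply: eq_bigr => i' _; rewrite mxE.
Qed.

Lemma has_dim_uniq (M : lmodType S) (V : M -> Prop) r1 r2 :
  has_dim V r1 -> has_dim V r2 -> r1 = r2.
Proof. by move=> h1 h2; apply/eqP; rewrite eqn_leq !(@has_dim_leq M V). Qed.

End Dimension.

(** The number of monomials of degree [d] in [q] variables. *)
Definition poly_dim (q d : nat) : nat := if q is q'.+1 then 'C(d + q', d) else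
  (d == 0%N).

Lemma monomials_ex q d : exists s : seq 'X_{1..q},
  [/\ uniq s, forall m, (m \in s) = (mdeg m == d) & size s = poly_dim q d].
Proof.
case: q => [|q].
  exists (if d == 0%N then [:: 0%MM] else [::]); rewrite /poly_dim;
    case: eqVneq => [->|d0]; split => //= m.
    by rewrite inE nvar0_mnmE eqxx mdeg0.
  by rewrite nvar0_mnmE mdeg0 eq_sym (negPf d0).
exists [seq s2m t | t : d.-tuple 'I_q.+1 <- enum (basis q.+1 d)].
split; [exact: uniq_basis | by move=> m;
  rewrite -basis_cover | exact: size_basis].
Qed.

Lemma poly_dimS q d :
  poly_dim q.+1 d.+1 = (poly_dim q.+1 d + poly_dim q d.+1)%N.
Proof.
case: q => [|q] /=; first by rewrite !addn0 !binn.
by rewrite addSn binS addnC addnS addSn.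
Qed.

(* As a module over K[X_0, ..., X_(k-1)], the variables X_q, X_(q+1), ... act
   by 0. *)
Definition polyMod (K : fieldType) (k q : nat) : Type := {mpoly K[q]}.
HB.instance Definition _ K k q := GRing.Zmodule.on (polyMod K k q).

Section PolynomialModule.
Variables (K : fieldType) (k q : nat).
Local Notation S := {mpoly K[k]}.
Local Notation polyMod := (polyMod K k q).

Definition coord_proj : k.-tuple {mpoly K[q]} :=
  [tuple oapp (fun j : 'I_q => 'X_j) 0 (insub (val i)) | i < k].

Definition polyMod_scale (p : S) (v : polyMod) : polyMod := (p \mPo coord_proj)
  * v.

Lemma polyMod_scaleA a b v : polyMod_scale a (polyMod_scale b v) =
  polyMod_scale (a * b) v.
Proof. by rewrite /polyMod_scale rmorphM mulrA. Qed.

Lemma polyMod_scale1 : left_id 1 polyMod_scale.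
Proof. by move=> v; rewrite /polyMod_scale rmorph1 mul1r. Qed.

Lemma polyMod_scaleDr : right_distributive polyMod_scale +%R.
Proof. by move=> p u v; rewrite /polyMod_scale mulrDr. Qed.

Lemma polyMod_scaleDl v : {morph polyMod_scale^~ v : a b / a + b}.
Proof. by move=> a b; rewrite /polyMod_scale rmorphD mulrDl. Qed.

HB.instance Definition _ := GRing.Zmodule_isLmodule.Build S polyMod
  polyMod_scaleA polyMod_scale1 polyMod_scaleDr polyMod_scaleDl.

Lemma polyMod_scaleE (p : S) (v : polyMod) : p *: v = (p \mPo coord_proj) * v
  :> {mpoly K[q]}.
Proof. by []. Qed.

Lemma coord_projX (i : 'I_k) (iq : (i < q)%N) : 'X_i \mPo coord_proj =
  'X_(Ordinal iq).
Proof. by rewrite comp_mpolyXU -tnth_nth tnth_mktuple insubT. Qed.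

Lemma coord_proj_homog e (p : S) : p \is e.-homog -> p \mPo coord_proj \is
  e.-homog.
Proof.
move=> pe; rewrite comp_mpolyE big_seq; apply: rpred_sum => m mp.
apply: rpredZ; rewrite -(dhomog_mf pe mp) /= mdegE.
apply: (big_ind2 (fun (u : {mpoly K[q]}) d => u \is d.-homog)).
- exact: dhomog1.
- by move=> u a v b; apply: dhomogM.
move=> i _; rewrite -[X in X.-homog]mul1n; apply: dhomogMn.
rewrite tnth_mktuple; case: insub => [j|] /=; last exact: dhomog0.
by rewrite dhomogX /= mdeg1.
Qed.

Variable delta : nat.

(** The grading is shifted so that the generator 1 has degree [delta]. *)
Definition polyMod_comp (d : int) (v : polyMod) : Prop :=
  {in msupp (v : {mpoly K[q]}), forall mu, (mdeg mu + delta)%:Z = d}.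

Lemma polyMod_comp0 d : polyMod_comp d 0.
Proof. by move=> mu; rewrite msupp0. Qed.

Lemma polyMod_compB d u v : polyMod_comp d u -> polyMod_comp d v ->
  polyMod_comp d (u - v).
Proof.
by move=> hu hv mu /msuppB_le; rewrite mem_cat => /orP[/hu|/hv].
Qed.

Lemma polyMod_compZ (e : nat) (d : int) (p : S) v :
  p \is e.-homog -> polyMod_comp d v -> polyMod_comp (e%:Z + d) (p *: v).
Proof.
move=> /coord_proj_homog hp hv mu; rewrite polyMod_scaleE.
move=> /msuppM_le/allpairsP[[m1 m2] /= [/(dhomog_mf hp) <- /hv <- ->]].
by rewrite mdegD /= -PoszD addnA.
Qed.

Lemma polyMod_comp_sum (v : polyMod) : exists (ds : seq int) (u : int ->
  polyMod),
  [/\ uniq ds, forall d, polyMod_comp d (u d) & v = \sum_(d <- ds) u d].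
Proof.
exists [seq (e + delta)%:Z | e <- iota 0 (msize (v : {mpoly K[q]}))].
exists (fun d => if d - delta%:Z is Posz e then pihomog mdeg e (v : {mpoly
  K[q]}) else 0).
split.
- by rewrite map_inj_uniq ?iota_uniq // => a b [] /addIn.
- move=> d; case dE: (d - delta%:Z) => [e|e]; last exact: polyMod_comp0.
  move=> mu /(dhomog_mf (pihomogP _ _ _)) /= ->; lia.
rewrite big_map [LHS](@pihomog_partitionE _ _ mdeg _ _ (leqnn _)).
rewrite -(big_mkord xpredT (fun e => pihomog mdeg e (v : {mpoly K[q]})))
  /index_iota subn0.
by apply: eq_bigr => e _; rewrite PoszD addrK.
Qed.

Lemma polyMod_comp_direct (ds : seq int) (u : int -> polyMod) :
  uniq ds -> (forall d, polyMod_comp d (u d)) -> \sum_(d <- ds) u d = 0 ->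
  {in ds, forall d, u d = 0}.
Proof.
move=> dsU hu u0 d dds; apply/mpolyP => mu; rewrite mcoeff0.
have [mud|mud] := eqVneq (mdeg mu + delta)%:Z d; last first.
  by apply: memN_msupp_eq0; apply: contraNN mud => /hu ->.
have : (\sum_(d <- ds) (u d : {mpoly K[q]}))@_mu = 0.
  by rewrite -[X in X@_mu]/(\sum_(d <- ds) u d) u0 mcoeff0.
rewrite raddf_sum (bigD1_seq d) //= big1 ?addr0 // => d' d'd.
by apply: memN_msupp_eq0; apply: contraNN d'd => /hu <-; rewrite mud.
Qed.

Definition poly_module : gradedModule K k :=
  GradedModule polyMod_comp0 polyMod_compB polyMod_compZ polyMod_comp_sum
    polyMod_comp_direct.

End PolynomialModule.

Lemma mcoeff_sum_monomials (K : fieldType) q (s : seq 'X_{1..q}) (c : 'X_{1..q}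
  -> K) mu :
  uniq s -> (\sum_(t <- s) c t *: 'X_[t])@_mu = if mu \in s then c mu else 0.
Proof.
move=> sU; rewrite raddf_sum /=.
under eq_bigr => t _ do rewrite mcoeffZ mcoeffX.
case: ifP => mus; last first.
  rewrite big_seq big1 // => t ts; case: eqVneq => [tmu|];
    last by rewrite mulr0.
  by rewrite -tmu ts in mus.
rewrite (bigD1_seq mu) //= eqxx mulr1 big1 ?addr0 // => t /negPf->.
by rewrite mulr0.
Qed.

Lemma mcoeffMX_neq0 (K : fieldType) q (p : {mpoly K[q]}) (m mu : 'X_{1..q}) :
  (p * 'X_[m])@_mu != 0 -> exists2 m', p@_m' != 0 & mu = (m + m')%MM.
Proof.
rewrite -mcoeff_msupp (perm_mem (msuppMX _ _)) => /mapP[m' m'p ->].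
by exists m'; rewrite -?mcoeff_msupp.
Qed.

(** Coefficients of z^delta/(1-z)^q. *)
Definition poly_hilb (q delta : nat) (d : int) : nat :=
  if (d - delta%:Z)%R is Posz e then poly_dim q e else 0%N.

Section PolynomialModuleTheory.
Variables (K : fieldType) (k q delta : nat).
Local Notation S := {mpoly K[k]}.
Local Notation N := (poly_module K k q delta).

Lemma polyMod_scaleC (c : K) (v : polyMod K k q) :
  (c%:MP : S) *: v = c *: (v : {mpoly K[q]}) :> {mpoly K[q]}.
Proof. by rewrite polyMod_scaleE comp_mpolyC mul_mpolyC. Qed.

Lemma polyMod_sumE (A : Type) (s : seq A) (F : A -> {mpoly K[q]}) :
  \sum_(a <- s) (F a : polyMod K k q) = \sum_(a <- s) F a :> {mpoly K[q]}.
Proof. by []. Qed.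

Lemma poly_module_hilbert : hilbert_series N (poly_hilb q delta).
Proof.
move=> d; rewrite /poly_hilb; case dE: (d - delta%:Z) => [e|e]; last first.
  apply: (@has_dim_seq _ _ _ _ 'I_0 [::] (fun=> 0)) => // v hv.
  exists (fun=> 0); rewrite big_nil; apply/mpolyP => mu; rewrite mcoeff0.
  by apply/memN_msupp_eq0/negP => /hv; lia.
have [s [sU sP <-]] := monomials_ex q e.
pose E (m : 'X_{1..q}) : polyMod K k q := ('X_[m] : {mpoly K[q]}).
have sumE (c : 'X_{1..q} -> K) :
    \sum_(t <- s) (c t)%:MP *: E t = \sum_(t <- s) c t *: 'X_[t] :> {mpoly
      K[q]}.
  rewrite -[RHS]polyMod_sumE; apply: eq_bigr => t _; exact: polyMod_scaleC.
apply: (@has_dim_seq _ _ _ _ _ s E) => //.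
- move=> m; rewrite sP => /eqP me mu; rewrite msuppX inE => /eqP ->; lia.
- move=> c; rewrite sumE => c0 t ts.
  have := mcoeff_sum_monomials c t sU; rewrite ts => <-.
  by rewrite c0 mcoeff0.
- move=> v hv; exists (fun m => (v : {mpoly K[q]})@_m); rewrite sumE.
  apply/mpolyP => mu; rewrite mcoeff_sum_monomials // sP; case: eqP => // mue.
  by apply/memN_msupp_eq0/negP => /hv; lia.
Qed.

Hypothesis qk : (q <= k)%N.

Lemma poly_module_fin_gen : fin_gen N.
Proof.
exists 1%N, (fun=> (1 : {mpoly K[q]})) => v.
pose t : q.-tuple S := [tuple 'X_(widen_ord qk i) | i < q].
exists (fun=> (v : {mpoly K[q]}) \mPo t); rewrite big_ord1.
rewrite [RHS]polyMod_scaleE mulr1 (comp_mpolyE _ t) raddf_sum /=.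
rewrite [LHS](mpolyE (v : {mpoly K[q]})).
apply: eq_bigr => m _; rewrite comp_mpolyZ rmorph_prod mpolyXE_id;
  apply: congr1.
apply: eq_bigr => i _; rewrite rmorphXn /= tnth_mktuple.
have iq : (widen_ord qk i < q)%N by exact: (ltn_ord i).
by rewrite (coord_projX K iq); congr ('X__ ^+ _); apply: val_inj.
Qed.

Definition vars (r : nat) : seq S := take r [seq 'X_i | i <- enum 'I_k].

Lemma size_vars r : (r <= k)%N -> size (vars r) = r.
Proof. by move=> rk; rewrite size_takel // size_map size_enum_ord. Qed.

Lemma nth_vars r i (ik : (i < k)%N) : (i < r)%N -> (vars r)`_i = 'X_(Ordinal
  ik).
Proof.
move=> ir; rewrite nth_take // (nth_map (Ordinal ik)) ?size_enum_ord //.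
by congr ('X__); apply: val_inj; rewrite /= nth_enum_ord.
Qed.

(** The first [i] variables generate a monomial ideal, so membership can be read off the support. *)
Lemma seq_mul_varsP i (v : N) : (i <= q)%N ->
  seq_mul (vars i) v <->
  {in msupp (v : {mpoly K[q]}), forall mu : 'X_{1..q}, exists2 j : 'I_q, (j <
    i)%N & mu j != 0%N}.
Proof.
move=> iq; have ik := leq_trans iq qk; rewrite seq_mulP size_vars //.
have termE (j : 'I_i) (u : N) : (vars i)`_j *: u =
    (u : {mpoly K[q]}) * 'X_(widen_ord iq j).
  rewrite nth_vars ?(leq_trans (ltn_ord j)) // => jk.
  rewrite polyMod_scaleE coord_projX ?(leq_trans (ltn_ord j)) //= => jq.
  by rewrite mulrC; congr (_ * 'X__); apply: val_inj.
split=> [[u ->] mu|hv].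
  move/msupp_sum_le/flattenP => [_ /mapP[j _ ->]].
  rewrite termE mcoeff_msupp => /mcoeffMX_neq0[m' _ ->].
  by exists (widen_ord iq j); rewrite //= mnmDE mnm1E eqxx.
(* Each monomial of [v] is assigned to one of the first [i] variables dividing it, and contributes
   to the coefficient of that variable only. *)
pose w (mu : 'X_{1..q}) := [pick j : 'I_i | mu (widen_ord iq j) != 0%N].
exists (fun j => oapp (fun j => \sum_(mu <- msupp (v : {mpoly K[q]}) | w mu ==
  Some j)
  (v : {mpoly K[q]})@_mu *: 'X_[mu - U_(widen_ord iq j)]) (0 : {mpoly K[q]})
    (insub j)).
under eq_bigr => j _ do rewrite valK /= termE mulr_suml big_mkcond.
rewrite exchange_big {1}[v : {mpoly K[q]}]mpolyE;
  apply: eq_big_seq => mu mup /=.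
rewrite {1}/w; case: pickP => [j muj|/= w0]; last first.
  by have [j ji muj] := hv mu mup; have := w0 (Ordinal ji);
    rewrite (_ : widen_ord _ _ = j) ?muj //; apply: val_inj.
rewrite (bigD1 j) //= eqxx big1 ?addr0 => [|j' j'j]; last first.
  by rewrite ifN //; apply: contraNneq j'j => -[->].
by rewrite -scalerAl -mpolyXD submK // lep1mP.
Qed.

(** Multiplication by X_i does not change the exponents of the earlier variables, which alone decide
    membership. *)
Lemma vars_regular i (v : N) : (i < q)%N ->
  seq_mul (vars i) ((vars i.+1)`_i *: v) -> seq_mul (vars i) v.
Proof.
move=> iq; have ik := leq_trans iq qk.
rewrite !seq_mul_varsP ?(ltnW iq) // (nth_vars ik) // polyMod_scaleE
  coord_projX => hv mu.
rewrite mcoeff_msupp => mup.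
have [|j ji] := hv (U_(Ordinal iq) + mu)%MM.
  by rewrite mcoeff_msupp mulrC mcoeffMX.
rewrite mnmDE mnm1E -val_eqE /= (gtn_eqF ji) add0n; by exists j.
Qed.

Lemma vars_proper i : (i <= q)%N -> ~ seq_mul (vars i) ((1 : {mpoly K[q]}) : N).
Proof.
move=> iq /seq_mul_varsP-/(_ iq) /(_ 0%MM)[|j _]; last by rewrite mnm0E.
by rewrite msupp1 inE.
Qed.

End PolynomialModuleTheory.

(** * Direct sums *)

Lemma sum_pair (U V : zmodType) (A : Type) (s : seq A) (f : A -> U) (g : A ->
  V) :
  \sum_(a <- s) (f a, g a) = (\sum_(a <- s) f a, \sum_(a <- s) g a).
Proof. by elim: s => [|a s IH]; rewrite ?big_nil // !big_cons IH. Qed.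

Section DirectSum.
Variables (K : fieldType) (k : nat) (M N : gradedModule K k).
Local Notation S := {mpoly K[k]}.

Definition dsum_comp (d : int) (v : M * N) : Prop := gcomp d v.1 /\ gcomp d v.2.

Lemma dsum_comp0 d : dsum_comp d 0.
Proof. by split; apply: gcomp0. Qed.

Lemma dsum_compB d u v : dsum_comp d u -> dsum_comp d v -> dsum_comp d (u - v).
Proof. by move=> [? ?] [? ?]; split; apply: gcompB. Qed.

Lemma dsum_compZ (e : nat) (d : int) (p : S) v :
  p \is e.-homog -> dsum_comp d v -> dsum_comp (e%:Z + d) (p *: v).
Proof. by move=> hp [? ?]; split; apply: gcompZ. Qed.

Lemma dsum_comp_sum (v : M * N) : exists (ds : seq int) (u : int -> M * N),
  [/\ uniq ds, forall d, dsum_comp d (u d) & v = \sum_(d <- ds) u d].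
Proof.
have [ds1 [u1 [U1 g1 z1 v1]]] := gcomp_decomp v.1.
have [ds2 [u2 [U2 g2 z2 v2]]] := gcomp_decomp v.2.
exists (undup (ds1 ++ ds2)), (fun d => (u1 d, u2 d)).
split; [exact: undup_uniq | by [] | rewrite sum_pair [v]surjective_pairing v1
  v2].
congr (_, _); apply: eq_sum_support => //; rewrite ?undup_uniq //.
  by move=> d; rewrite mem_undup mem_cat => ->.
by move=> d; rewrite mem_undup mem_cat orbC => ->.
Qed.

Lemma dsum_comp_direct (ds : seq int) (u : int -> M * N) :
  uniq ds -> (forall d, dsum_comp d (u d)) -> \sum_(d <- ds) u d = 0 ->
  {in ds, forall d, u d = 0}.
Proof.
move=> dsU hu; under eq_bigr => d _ do rewrite [u d]surjective_pairing.
rewrite sum_pair => -[e1 e2] d dds; rewrite [u d]surjective_pairing.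
rewrite (@gcomp_direct _ _ M ds (fun d => (u d).1)) //.
  rewrite (@gcomp_direct _ _ N ds (fun d => (u d).2)) //.
  by move=> d'; case: (hu d').
by move=> d'; case: (hu d').
Qed.

Definition dsum_module : gradedModule K k :=
  GradedModule dsum_comp0 dsum_compB dsum_compZ dsum_comp_sum dsum_comp_direct.

Lemma dsum_fin_gen : fin_gen M -> fin_gen N -> fin_gen dsum_module.
Proof.
move=> [r1 [g1 gen1]] [r2 [g2 gen2]].
exists (r1 + r2)%N, (fun i => match split i with inl j => (g1 j, 0) | inr j =>
  (0, g2 j) end).
move=> v; have [c1 v1] := gen1 v.1; have [c2 v2] := gen2 v.2.
exists (fun i => match split i with inl j => c1 j | inr j => c2 j end).
rewrite big_split_ord /=.
under eq_bigr => j _ do rewrite (unsplitK (inl j)).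
under [X in _ + X]eq_bigr => j _ do rewrite (unsplitK (inr j)).
rewrite [v]surjective_pairing v1 v2.
rewrite (eq_bigr (fun j => (c1 j *: g1 j, 0 : N))); last first.
  by move=> j _; congr (_, _); exact: scaler0.
rewrite [X in _ + X](eq_bigr (fun j => (0 : M, c2 j *: g2 j))); last first.
  by move=> j _; congr (_, _); exact: scaler0.
by rewrite !sum_pair !big1_eq; congr (_, _); rewrite ?addr0 ?add0r.
Qed.

Lemma dsum_hilbert HM HN : hilbert_series M HM -> hilbert_series N HN ->
  hilbert_series dsum_module (fun d => (HM d + HN d)%N).
Proof.
move=> hM hN d; have [e1 [V1 free1 gen1]] := hM d;
  have [e2 [V2 free2 gen2]] := hN d.
pose e i : M * N :=
  match split i with inl j => (e1 j, 0) | inr j => (0, e2 j) end.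
have sumE (c : 'I_(HM d + HN d) -> K) : \sum_i (c i)%:MP *: e i =
    (\sum_j (c (lshift _ j))%:MP *: e1 j, \sum_j (c (rshift _ j))%:MP *: e2 j).
  rewrite big_split_ord /= /e.
  under eq_bigr => j _ do rewrite (unsplitK (inl j)).
  under [X in _ + X]eq_bigr => j _ do rewrite (unsplitK (inr j)).
  rewrite (eq_bigr (fun j => ((c (lshift _ j))%:MP *: e1 j, 0 : N)));
    last first.
    by move=> j _; congr (_, _); exact: scaler0.
  rewrite [X in _ + X](eq_bigr (fun j => (0 : M, (c (rshift _ j))%:MP *: e2
    j))); last first.
    by move=> j _; congr (_, _); exact: scaler0.
  by rewrite !sum_pair !big1_eq; congr (_, _); rewrite ?addr0 ?add0r.
exists e; split.
- move=> i; rewrite /e; case: split => j; split=> //=; exact: gcomp0.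
- move=> c; rewrite sumE => -[/free1 c1 /free2 c2] i.
  by rewrite -(splitK i); case: split => j /=.
- move=> v [/gen1[c1 v1] /gen2[c2 v2]].
  exists (fun i => match split i with inl j => c1 j | inr j => c2 j end).
  rewrite sumE [v]surjective_pairing v1 v2; congr (_, _); apply: eq_bigr => j _.
    by rewrite (unsplitK (inl j)).
  by rewrite (unsplitK (inr j)).
Qed.

Lemma dsum_seq_mul (rs : seq S) (v : dsum_module) :
  seq_mul rs v <-> seq_mul rs v.1 /\ seq_mul rs v.2.
Proof.
split=> [[u ->]|[[u1 e1] [u2 e2]]].
  have -> : \sum_(i < size rs) rs`_i *: u i =
      (\sum_(i < size rs) rs`_i *: (u i).1, \sum_(i < size rs) rs`_i *: (u
        i).2).
    by rewrite -sum_pair; apply: eq_bigr => i _.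
  by split; [exists (fun i => (u i).1) | exists (fun i => (u i).2)].
by exists (fun i => (u1 i, u2 i));
  rewrite [v]surjective_pairing e1 e2 -sum_pair.
Qed.

End DirectSum.

Lemma poly_module_regular (K : fieldType) k q delta r : (r <= q)%N -> (q <=
  k)%N ->
  regular_seq (poly_module K k q delta) (vars K k r).
Proof.
move=> rq qk; have rk := leq_trans rq qk.
split; last by exists (1 : {mpoly K[q]}); apply: vars_proper.
move=> i; rewrite size_vars // => ir v; rewrite take_takel ?(ltnW ir) //.
have iq := leq_trans ir rq.
have -> : (vars K k r)`_i = (vars K k i.+1)`_i.
  by rewrite !(nth_vars K (leq_trans ir rk)).
exact: vars_regular.
Qed.

Lemma dsum_regular (K : fieldType) k (M N : gradedModule K k) rs :
  regular_seq M rs -> regular_seq N rs -> regular_seq (dsum_module M N) rs.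
Proof.
move=> [Mreg [w wM]] [Nreg _]; split; last first.
  by exists (w, 0) => /dsum_seq_mul[].
move=> i ilt v /dsum_seq_mul[/(Mreg _ ilt) v1 /(Nreg _ ilt) v2].
exact/dsum_seq_mul.
Qed.

(** An empty list would give the zero module, on which no sequence is regular. *)
Lemma regular_module_ex (K : fieldType) (k r : nat) (L : seq (nat * nat)) :
  L != [::] -> (forall qd, qd \in L -> (r <= qd.1 <= k)%N) ->
  exists N : gradedModule K k,
    [/\ fin_gen N, hilbert_series N (fun d => \sum_(qd <- L) poly_hilb qd.1
      qd.2 d)%N
      & regular_seq N (vars K k r)].
Proof.
case: L => // qd L _; elim: L qd => [|qd' L IH] qd hL.
  have /andP[rq qk] := hL qd (mem_head _ _).
  exists (poly_module K k qd.1 qd.2); split.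
  - exact: poly_module_fin_gen.
  - have -> : (fun d => \sum_(qd <- [:: qd]) poly_hilb qd.1 qd.2 d)%N =
    poly_hilb qd.1 qd.2.
      by apply: funext => d; rewrite big_seq1.
    exact: poly_module_hilbert.
  - exact: poly_module_regular.
have /andP[rq qk] := hL qd (mem_head _ _).
have [|N [Nfg NH Nreg]] := IH qd'.
  by move=> x xL; apply: hL; rewrite inE xL orbT.
exists (dsum_module (poly_module K k qd.1 qd.2) N); split.
- by apply: dsum_fin_gen => //; apply: poly_module_fin_gen.
- have -> : (fun d => \sum_(qd <- [:: qd, qd' & L]) poly_hilb qd.1 qd.2 d)%N =
      fun d => (poly_hilb qd.1 qd.2 d + \sum_(qd <- qd' :: L) poly_hilb qd.1
        qd.2 d)%N.
    by apply: funext => d; rewrite big_cons.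
  by apply: dsum_hilbert => //; apply: poly_module_hilbert.
- by apply: dsum_regular => //; apply: poly_module_regular.
Qed.

(** * The Hilbert function of the bipartite quotient *)

Section BipartiteHilbert.
Variables (K : fieldType) (n m : nat).
Local Notation S := {mpoly K[n + m]}.

(** The monomials outside the edge ideal: those in the x variables only or in the y variables
    only. *)
Definition unmixed (mu : 'X_{1..n + m}) : bool :=
  [forall j, mu (rshift n j) == 0%N] || [forall i, mu (lshift m i) == 0%N].

(** Degree 0 is separate because the monomial 1 belongs to both kinds. *)
Definition Knm_hilb (d : int) : nat :=
  if d is Posz e then
    (if e == 0%N then 1 else poly_dim n e + poly_dim m e)%N
  else 0%N.

Definition mnml (mu : 'X_{1..n}) : 'X_{1..n + m} :=
  [multinom (match split i with inl j => mu j | inr _ => 0%N end) | i < n + m].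

Definition mnmr (mu : 'X_{1..m}) : 'X_{1..n + m} :=
  [multinom (match split i with inl _ => 0%N | inr j => mu j end) | i < n + m].

Lemma mnml_lr mu : (forall i, mnml mu (lshift m i) = mu i) /\
                   (forall j, mnml mu (rshift n j) = 0%N).
Proof. by split=> i; rewrite mnmE ?(unsplitK (inl i)) ?(unsplitK (inr i)). Qed.

Lemma mnmr_lr mu : (forall i, mnmr mu (lshift m i) = 0%N) /\
                   (forall j, mnmr mu (rshift n j) = mu j).
Proof. by split=> i; rewrite mnmE ?(unsplitK (inl i)) ?(unsplitK (inr i)). Qed.

Lemma mdeg_mnml mu : mdeg (mnml mu) = mdeg mu.
Proof.
rewrite !mdegE big_split_ord /= [X in (_ + X)%N]big1 ?addn0 => [|j _].
  by apply: eq_bigr => i _; rewrite (mnml_lr mu).1.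
by rewrite (mnml_lr mu).2.
Qed.

Lemma mdeg_mnmr mu : mdeg (mnmr mu) = mdeg mu.
Proof.
rewrite !mdegE big_split_ord /= big1 ?add0n => [|j _].
  by apply: eq_bigr => i _; rewrite (mnmr_lr mu).2.
by rewrite (mnmr_lr mu).1.
Qed.

Lemma unmixed_monomials_ex e : exists s : seq 'X_{1..n + m},
  [/\ uniq s, forall mu, (mu \in s) = (mdeg mu == e) && unmixed mu
    & size s = Knm_hilb e].
Proof.
rewrite /Knm_hilb; case: eqVneq => [->|e0].
  exists [:: 0%MM]; split => // mu; rewrite inE mdeg_eq0; case: eqP => // ->.
  by rewrite /unmixed; apply/esym/orP; left; apply/forallP => j; rewrite mnm0E.
have [s1 [U1 P1 <-]] := monomials_ex n e;
  have [s2 [U2 P2 <-]] := monomials_ex m e.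
have lI : injective mnml.
  by move=> a b ab; apply/mnmP => i; rewrite -(mnml_lr a).1 ab (mnml_lr b).1.
have rI : injective mnmr.
  by move=> a b ab; apply/mnmP => i; rewrite -(mnmr_lr a).2 ab (mnmr_lr b).2.
exists (map mnml s1 ++ map mnmr s2); split; last by rewrite size_cat !size_map.
  rewrite cat_uniq !map_inj_uniq // U1 U2 andbT /=;
    apply/hasPn => _ /mapP[b bs ->].
  (* A monomial in both lists has all exponents zero, against [e0]. *)
  apply/mapP => -[a _ ab]; move: bs; rewrite P2 => /eqP be; move: e0.
  rewrite -be -mdeg_mnmr mdegE big_split_ord /= !big1 ?eqxx // => i _.
    by rewrite ab (mnml_lr a).2.
  by rewrite (mnmr_lr b).1.
move=> mu; rewrite mem_cat; apply/orP/andP.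
- case=> /mapP[a]; rewrite ?P1 ?P2 => /eqP ae ->.
    rewrite mdeg_mnml ae eqxx; split=> //; apply/orP; left.
    by apply/forallP => j; rewrite (mnml_lr a).2.
  rewrite mdeg_mnmr ae eqxx; split=> //; apply/orP; right.
  by apply/forallP => j; rewrite (mnmr_lr a).1.
- case=> /eqP mue /orP[]/forallP mu0; [left|right]; apply/mapP.
    pose a := [multinom mu (lshift m i) | i < n].
    have muE : mu = mnml a.
      apply/mnmP => i; rewrite -[i]splitK; case: (split i) => j /=.
        by rewrite (mnml_lr a).1 mnmE.
      by rewrite (mnml_lr a).2; apply/eqP.
    by exists a => //; rewrite P1 -mdeg_mnml -muE mue.
  pose a := [multinom mu (rshift n i) | i < m].
  have muE : mu = mnmr a.
    apply/mnmP => i; rewrite -[i]splitK; case: (split i) => j /=.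
      by rewrite (mnmr_lr a).1; apply/eqP.
    by rewrite (mnmr_lr a).2 mnmE.
  by exists a => //; rewrite P2 -mdeg_mnmr -muE mue.
Qed.

Lemma Knm_ideal_unmixed (p : S) mu : p \in @Knm_ideal K n m -> unmixed mu ->
  p@_mu = 0.
Proof.
move=> /Knm_idealP[c ->] mu0; rewrite raddf_sum big1 //= => i _.
rewrite raddf_sum big1 //= => j _; apply/eqP; apply: contraTT mu0.
rewrite /xvar /yvar -mpolyXD => /mcoeffMX_neq0[mu' _ ->].
rewrite negb_or; apply/andP; split; apply/forallPn; [exists j | exists i].
  by rewrite !mnmDE !mnm1E eqxx addn1.
by rewrite !mnmDE !mnm1E eqxx.
Qed.

(** A mixed monomial is divisible by some x_i y_j. Together with [Knm_ideal_unmixed], this makes the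
    unmixed monomials a basis of the quotient. *)
Lemma mixed_Knm_ideal (p : S) :
  {in msupp p, forall mu, ~~ unmixed mu} -> p \in @Knm_ideal K n m.
Proof.
move=> hp; rewrite [p]mpolyE big_seq; apply: rpred_sum => mu /hp.
rewrite negb_or => /andP[/forallPn[j muj] /forallPn[i mui]].
pose U : 'X_{1..n + m} := (U_(lshift m i) + U_(rshift n j))%MM.
have le : (U <= mu)%MM.
  apply/mnm_lepP => l; rewrite mnmDE !mnm1E.
  case: eqP => [<-|_]; first by rewrite eq_rlshift /= addn0 lt0n.
  by case: eqP => [<-|_] //=; rewrite add0n lt0n.
rewrite -(submK le) mpolyXD scalerAl; apply: Knm_idealM.
apply/Knm_idealP; exists (fun i' j' => if (i' == i) && (j' == j) then 1 else 0).
rewrite (bigD1 i) //= (bigD1 j) //= !eqxx mul1r !big1 ?addr0 //.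
- by rewrite /xvar /yvar -mpolyXD.
- by move=> i' /negPf->; rewrite big1 // => j' _; rewrite mul0r.
- by move=> j' /negPf->; rewrite mul0r.
Qed.

Lemma Knm_hilbert : hilbert_series (Knm_module K n m) Knm_hilb.
Proof.
case=> e; last first.
  apply: (@has_dim_seq _ _ _ _ 'I_0 [::] (fun=> 0)) => // v /Knm_comp_neg ->.
  by exists (fun=> 0); rewrite big_nil.
have [s [sU sP <-]] := unmixed_monomials_ex e.
have sumE (c : 'X_{1..n + m} -> K) :
    \sum_(t <- s) (c t)%:MP *: Knm_proj ('X_[t] : S) =
    Knm_proj (\sum_(t <- s) c t *: 'X_[t]).
  by rewrite raddf_sum; apply: eq_bigr => t _ /=; rewrite -mul_mpolyC Knm_projM.
apply: (@has_dim_seq _ _ _ _ _ s (fun t => Knm_proj 'X_[t])) => //.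
- move=> t; rewrite sP => /andP[/eqP te _]; apply/Knm_comp_homog.
  by exists 'X_[t] => //; rewrite dhomogX /= te.
- move=> c; rewrite sumE => /Knm_proj_eq0 cI t ts.
  have := mcoeff_sum_monomials c t sU; rewrite ts => <-.
  by apply: Knm_ideal_unmixed cI _; move: ts; rewrite sP => /andP[].
- move=> v /Knm_comp_homog[p pe ->]; exists (fun t => p@_t); rewrite sumE.
  apply/Knm_proj_eq/mixed_Knm_ideal => mu; rewrite mcoeff_msupp.
  apply: contraNN => mu0; rewrite mcoeffB mcoeff_sum_monomials // sP mu0 andbT.
  case: (mdeg mu =P e) => [_|/eqP ne] /=; first by rewrite subrr eqxx.
  rewrite subr0.
  by apply/eqP; apply: dhomog_nemf_coeff pe ne.
Qed.

End BipartiteHilbert.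

(** * Hilbert decompositions *)

(** Coefficients of f/(1-z), inverse to [diff]. *)
Definition integ (f : nat -> int) (d : nat) : int := \sum_(e < d.+1) f e.

Lemma integ_diff f : integ (diff f) = f.
Proof.
apply: funext; elim=> [|d IH]; rewrite /integ ?big_ord1 // big_ord_recr /=.
by rewrite -[X in X + _]/(integ (diff f) d) IH addrC subrK.
Qed.

Lemma iter_integ_diff r f : iter r integ (iter r diff f) = f.
Proof. by elim: r f => // r IH f; rewrite iterSr /= integ_diff IH. Qed.

Lemma diff_ge0 f : (forall d, 0 <= diff f d) -> forall d, 0 <= f d.
Proof.
move=> f0; elim=> [|d IH]; first exact: (f0 0%N).
by have /= := f0 d.+1; rewrite subr_ge0; apply: le_trans.
Qed.

Lemma iter_diff_ge0 r r' f : (r <= r')%N ->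
  (forall d, 0 <= iter r' diff f d) -> forall d, 0 <= iter r diff f d.
Proof.
move=> /subnK <-; elim: (r' - r)%N => // j IH f0; apply: IH.
exact: (diff_ge0 f0).
Qed.

(** The coefficient of z^2 in (1-z)^r f, doubled to keep r(r-1)/2 integral. *)
Lemma iter_diff2 r (f : nat -> int) :
  2 * iter r diff f 2%N = 2 * f 2%N - 2 * r%:Z * f 1%N + r%:Z * (r%:Z - 1) * f
    0%N.
Proof.
suff [_ _ //] : [/\ iter r diff f 0%N = f 0%N,
  iter r diff f 1%N = f 1%N - r%:Z * f 0%N &
  2 * iter r diff f 2%N = 2 * f 2%N - 2 * r%:Z * f 1%N + r%:Z * (r%:Z - 1) * f
    0%N].
elim: r => [|r [IH0 IH1 IH2]]; first by split => /=; ring.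
rewrite !iterS /= (_ : r.+1%:Z = r%:Z + 1); last by lia.
split=> //; first by rewrite IH1 IH0; ring.
by rewrite mulrBr IH2 IH1; ring.
Qed.

Lemma iter_diff_addsub r (f g k : nat -> int) :
  iter r diff (fun d => f d + g d - k d) =
  fun d => iter r diff f d + iter r diff g d - iter r diff k d.
Proof.
elim: r => // r IH; rewrite iterS IH; apply: funext => -[|d] //=; ring.
Qed.

Definition poly_dimz (q d : nat) : int := (poly_dim q d)%:Z.

(* Coefficients of (1 - z) ^ r. *)
Definition signed_bin (r d : nat) : int := (-1) ^+ d * ('C(r, d))%:Z.

Lemma poly_dim0 q : poly_dim q 0 = 1%N.
Proof. by case: q => //= q; rewrite bin0. Qed.

Lemma diff_poly_dim q : diff (poly_dimz q.+1) = poly_dimz q.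
Proof.
apply: funext => -[|d]; rewrite /diff /poly_dimz ?poly_dim0 //.
by rewrite poly_dimS PoszD addrC addKr.
Qed.

Lemma diff_signed_bin r : diff (signed_bin r) = signed_bin r.+1.
Proof.
apply: funext => -[|d]; rewrite /diff /signed_bin ?bin0 //.
by rewrite binS PoszD exprS; ring.
Qed.

Lemma signed_bin0 : poly_dimz 0 = signed_bin 0.
Proof. by apply: funext => -[|d];
  rewrite /poly_dimz /signed_bin /= ?bin0n ?mulr0. Qed.

Lemma iter_diff_poly_dim r q : iter r diff (poly_dimz q) =
  if (r <= q)%N then poly_dimz (q - r) else signed_bin (r - q).
Proof.
elim: r => [|r IH]; first by rewrite subn0.
rewrite iterS IH; case: (ltngtP r q) => [rq|qr|->].
- by rewrite -[RHS]diff_poly_dim -subSn // subSS.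
- by rewrite diff_signed_bin subSn // ltnW.
- by rewrite subnn signed_bin0 diff_signed_bin subSnn.
Qed.

(* f is the coefficient sequence of a finite sum of series
   z ^ delta / (1 - z) ^ q with a <= q <= b. *)
Definition hilb_sum (a b : nat) (f : nat -> int) : Prop :=
  exists L : seq (nat * nat), {in L, forall qd, (a <= qd.1 <= b)%N} /\
    forall d : nat, f d = (\sum_(qd <- L) poly_hilb qd.1 qd.2 d)%N%:Z.

Lemma hilb_sumD a b f g : hilb_sum a b f -> hilb_sum a b g ->
  hilb_sum a b (fun d => f d + g d).
Proof.
move=> [L1 [h1 e1]] [L2 [h2 e2]]; exists (L1 ++ L2); split.
  by move=> qd; rewrite mem_cat => /orP[/h1|/h2].
by move=> d; rewrite big_cat PoszD e1 e2.
Qed.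

Lemma hilb_sum_weaken a b a' b' f : (a' <= a)%N -> (b <= b')%N ->
  hilb_sum a b f -> hilb_sum a' b' f.
Proof.
move=> aa bb [L [h e]]; exists L; split=> // qd /h/andP[aq qb].
by rewrite (leq_trans aa aq) (leq_trans qb bb).
Qed.

Lemma poly_hilb_ge q delta (d : nat) : (delta <= d)%N ->
  poly_hilb q delta d = poly_dim q (d - delta).
Proof. by move=> le; rewrite /poly_hilb subzn. Qed.

Lemma poly_hilb_lt q delta (d : nat) : (d < delta)%N -> poly_hilb q delta d =
  0%N.
Proof. by rewrite /poly_hilb => lt; case E: (d%:Z - delta%:Z) => [e|//];
  lia. Qed.

Lemma diff_poly_hilb q delta :
  diff (fun d => (poly_hilb q.+1 delta d)%:Z) = fun d => (poly_hilb q delta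
    d)%:Z.
Proof.
apply: funext => -[|d] /=.
  case: (posnP delta) => [->|d0]; last by rewrite !poly_hilb_lt.
  by rewrite !poly_hilb_ge // !poly_dim0.
case: (ltngtP delta d.+1) => [lt|gt|->].
- by rewrite !poly_hilb_ge ?(ltnW lt) // subSn // poly_dimS PoszD addrC addKr.
- by rewrite !poly_hilb_lt // ltnW.
- by rewrite [in X in _ - X]poly_hilb_lt // !poly_hilb_ge // subnn !poly_dim0.
Qed.

Lemma integ_poly_hilb q delta :
  integ (fun d => (poly_hilb q delta d)%:Z) = fun d => (poly_hilb q.+1 delta
    d)%:Z.
Proof. by rewrite -diff_poly_hilb integ_diff. Qed.

Lemma hilb_sum_integ a b f : hilb_sum a b f -> hilb_sum a.+1 b.+1 (integ f).
Proof.
move=> [L [h e]]; exists [seq (qd.1.+1, qd.2) | qd <- L]; split.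
  by move=> qd /mapP[qd' /h]; case: qd' => q' d' /= ? ->.
move=> d; rewrite big_map /integ.
rewrite (eq_bigr (fun i : 'I_d.+1 => \sum_(qd <- L) (poly_hilb qd.1 qd.2
  i)%:Z)); last first.
  by move=> i _; rewrite e (big_morph Posz PoszD (erefl _)).
rewrite exchange_big (big_morph Posz PoszD (erefl _));
  apply: eq_bigr => qd _ /=.
by rewrite -[LHS]/(integ (fun d => (poly_hilb qd.1 qd.2 d)%:Z) d)
  integ_poly_hilb.
Qed.

Lemma hilb_sum_iter_integ r a b f :
  hilb_sum a b f -> hilb_sum (a + r) (b + r) (iter r integ f).
Proof.
by move=> h; elim: r => [|r IH]; rewrite ?addn0 // !addnS;
  apply: hilb_sum_integ.
Qed.

Lemma hilb_sum_single (D c : nat) :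
  hilb_sum 0 0 (fun d => if d == D then c%:Z else 0).
Proof.
exists (nseq c (0%N, D)); split; first by move=> qd;
  rewrite mem_nseq => /andP[_ /eqP->].
move=> d; rewrite big_nseq /= iter_addn_0; case: ltngtP => [lt|gt|->].
- by rewrite poly_hilb_lt.
- by rewrite poly_hilb_ge ?(ltnW gt) //= subn_eq0 leqNgt gt.
- by rewrite poly_hilb_ge // subnn mul1n.
Qed.

Lemma hilb_sum_finite D f : (forall d, 0 <= f d) -> (forall d, (D <= d)%N -> f
  d = 0) ->
  hilb_sum 0 0 f.
Proof.
elim: D f => [|D IH] f f0 fD.
  by exists [::]; split=> // d; rewrite big_nil fD.
have -> : f = fun d => (if d == D then 0 else f d) + (if d == D then `|f
  D|%N%:Z else 0).
  apply: funext => d; case: eqP => [->|_]; last by rewrite addr0.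
  by rewrite add0r abszE ger0_norm.
apply: hilb_sumD; last exact: hilb_sum_single.
apply: IH => d; first by case: ifP.
by case: eqVneq => // dD Dd; apply: fD; rewrite ltn_neqAle eq_sym dD.
Qed.

(** Induction on [q]: the difference of the tail for q + 1 is the tail for [q], plus at degree [D]
    the truncated term [poly_dim q.+1 D.-1]. For q = 0 the tail is zero because [D] is positive. *)
Lemma hilb_sum_tail q D : (0 < D)%N ->
  hilb_sum 0 q (fun d => if (D <= d)%N then poly_dimz q d else 0).
Proof.
move=> D0; elim: q => [|q IH].
  exists [::]; split=> // d; rewrite big_nil; case: ifP => // Dd.
  by rewrite /poly_dimz /= eqn0Ngt (leq_trans D0 Dd).
set f := fun d => _;
  suff -> : f = integ (fun d => (if (D <= d)%N then poly_dimz q d else 0) +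
    (if d == D then (poly_dim q.+1 D.-1)%:Z else 0)).
  apply: (@hilb_sum_weaken 1 q.+1) => //; apply: hilb_sum_integ.
  by apply: hilb_sumD => //; apply: hilb_sum_weaken (hilb_sum_single _ _).
rewrite -[LHS]integ_diff; congr integ; apply: funext => -[|d]; rewrite /f /=.
  by rewrite leqNgt D0 /= eq_sym eqn0Ngt D0.
rewrite /poly_dimz; case: (ltngtP D d.+1) => [lt|gt|->].
- by rewrite -ltnS lt poly_dimS PoszD addrC addKr addr0.
- by rewrite leqNgt ltnW.
- by rewrite ltnn subr0 poly_dimS addrC PoszD.
Qed.

Lemma Knm_hilb_split n m (d : nat) :
  (Knm_hilb n m d)%:Z = poly_dimz n d + poly_dimz m d - poly_dimz 0 d.
Proof.
rewrite /Knm_hilb /poly_dimz; case: eqP => [->|/eqP d0];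
  first by rewrite !poly_dim0.
by rewrite PoszD /= (negPf d0) subr0.
Qed.

(** For n./2 = a + 1 and d at least 2, ceil(n/2) is at most d + a. At d = 1 the inequality fails for
    odd [n]. *)
Lemma leq_bin_poly_dim n d : (1 < d)%N -> ('C(uphalf n, d) <= poly_dim n./2
  d)%N.
Proof.
move=> d1; case E: n./2 => [|a] /=.
  by rewrite bin_small // (leq_ltn_trans _ d1) //; lia.
by apply: leq_bin2l; lia.
Qed.

(** Multiplying by (1-z)^r leaves [G], the coefficients of (1-z)^(r-n) + (1-z)^(r-m) - (1-z)^r. A
    decomposition of [G] with exponents from 0 to n - r is then integrated [r] times. *)
Lemma Knm_hilb_sum n m : (0 < m <= n)%N ->
  hilb_sum (uphalf n) n (fun d => (Knm_hilb n m d)%:Z).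
Proof.
move=> /andP[m0 mn]; set r := uphalf n.
have rn : (r <= n)%N by rewrite /r; lia.
rewrite -[X in hilb_sum _ _ X](iter_integ_diff r).
rewrite -[X in hilb_sum X]add0n -[X in hilb_sum _ X](subnK rn).
apply: hilb_sum_iter_integ.
have -> : (fun d : nat => (Knm_hilb n m d)%:Z) =
    fun d => poly_dimz n d + poly_dimz m d - poly_dimz 0 d.
  by apply: funext => d; rewrite Knm_hilb_split.
rewrite iter_diff_addsub !iter_diff_poly_dim rn.
have -> : (if (r <= 0)%N then poly_dimz (0 - r) else signed_bin (r - 0)) =
  signed_bin r.
  by rewrite subn0; case: (r) => //=; rewrite signed_bin0.
have nr : (n - r)%N = n./2 by rewrite /r; lia.
set G := fun d => _.
pose tail q d := if (r < d)%N then poly_dimz q d else 0.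
(* Beyond degree [r] the polynomial terms are zero and only tails of series 1/(1-z)^q remain; up to
   degree [r] there are finitely many coefficients, shown nonnegative below. *)
have GE : G = fun d => (if (d <= r)%N then G d else 0) + (tail (n - r)%N d +
    (if (r <= m)%N then tail (m - r)%N d else 0)).
  apply: funext => d; rewrite /tail; case: leqP => [_|rd]; first by case: ifP;
    rewrite !addr0.
  rewrite /G add0r;
    have -> : signed_bin r d = 0 by rewrite /signed_bin bin_small // mulr0.
  rewrite subr0; case: ifP => // /negbT mr; congr (_ + _).
  by rewrite /signed_bin bin_small ?mulr0 // (leq_ltn_trans (leq_subr _ _)).
rewrite GE; apply: hilb_sumD; last first.
  apply: hilb_sumD; first exact: hilb_sum_tail.
  case: (leqP r m) => [rm|_].
    by apply: (@hilb_sum_weaken 0 (m - r)) => //;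
      [exact: leq_sub2r | exact: hilb_sum_tail].
  by exists [::]; split=> // d; rewrite big_nil.
apply: (@hilb_sum_weaken 0 0) => //; apply: (@hilb_sum_finite r.+1) => d;
  last first.
  by rewrite ltnNge; case: ifP.
case: ifP => // _; rewrite /G nr; have sgn : (-1) ^+ d = 1 - 2 * (odd d)%:Z.
  by rewrite -signr_odd; case: odd.
(* In degree 0 the value is 1 + 1 - 1. For d > 1, [le1] absorbs the term -C(r,d) of even degree; in
   odd degree its sign is positive, and [le2] lets it absorb -C(r-m,d). Degree 1 is like the odd
   case. *)
case: (ltngtP d 1) => [|d1|->].
- rewrite ltnS leqn0 => /eqP ->; case: ifP => _;
  by rewrite /poly_dimz /signed_bin !poly_dim0 !bin0.
- have := leq_bin_poly_dim n d1; rewrite -/r => le1.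
  have le2 : ('C(r - m, d) <= 'C(r, d))%N by apply: leq_bin2l; exact: leq_subr.
  by case: ifP => _; rewrite /poly_dimz /signed_bin sgn; case: odd => /=; lia.
have le2 : ('C(r - m, 1) <= 'C(r, 1))%N by apply: leq_bin2l; exact: leq_subr.
by case: ifP => _; rewrite /poly_dimz /signed_bin expr1; lia.
Qed.

(** * Hilbert depth *)

Lemma Knm_hdepth_ge (K : fieldType) (n m : nat) : (0 < m <= n)%N ->
  exists N : gradedModule K (n + m),
    [/\ fin_gen N, same_hilbert_series (Knm_module K n m) N
      & regular_seq N (vars K (n + m) (uphalf n))].
Proof.
move=> mn; have [L [hL eL]] := Knm_hilb_sum mn.
have [|qd /hL /andP[rq qn]|N [Nfg NH Nreg]] :=
  @regular_module_ex K (n + m) (uphalf n) L.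
(* The list is nonempty because the Hilbert function is 1 in degree 0. *)
- by apply: contra_eqN (eL 0%N) => /eqP ->; rewrite big_nil.
- by rewrite rq (leq_trans qn) // leq_addr.
exists N; split=> //; exists (Knm_hilb n m); split; first exact: Knm_hilbert.
have -> : Knm_hilb n m = fun d => \sum_(qd <- L) poly_hilb qd.1 qd.2 d.
  apply: funext => -[d|d]; first by have [] := eL d.
  by rewrite big1 // => qd _; rewrite /poly_hilb;
    case E: (Negz d - _) => [e|//]; lia.
exact: NH.
Qed.

Lemma poly_dim12 q : (poly_dim q 1 = q) /\ (2 * poly_dim q 2 = q * q.+1)%N.
Proof.
have p1 q' : poly_dim q' 1 = q'.
  by elim: q' => // q' IH; rewrite poly_dimS poly_dim0 IH add1n.
split=> //; elim: q => // q IH; rewrite poly_dimS p1; nia.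
Qed.

(** The expression assumed negative is twice the coefficient of z^2 in (1-z)^(h+1) H, with H(0) = 1,
    H(1) = n + m and 2H(2) = n(n+1) + m(m+1). A regular sequence longer than [h] would make it
    nonnegative. *)
Lemma Knm_regular_seq_size (K : fieldType) (n m h : nat) (N : gradedModule K (n
  + m))
    (rs : seq {mpoly K[n + m]}) :
  (n%:Z * (n%:Z + 1) + m%:Z * (m%:Z + 1) - 2 * (h%:Z + 1) * (n%:Z + m%:Z) +
   (h%:Z + 1) * h%:Z < 0) ->
  same_hilbert_series (Knm_module K n m) N ->
  {in rs, forall p : {mpoly K[n + m]}, p@_0%MM = 0} -> regular_seq N rs ->
  (size rs <= h)%N.
Proof.
move=> neg [H [HM HN]] rs0 reg; rewrite leqNgt; apply/negP => hs.
have HE d : H d = Knm_hilb n m d by apply: has_dim_uniq (HM d) (Knm_hilbert _ _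
  _ d).
have pos := iter_diff_ge0 hs (regular_seq_diff_ge0 HN (HE (-1)) rs0 reg).
have := pos 2%N; rewrite -(pmulr_rge0 _ (isT : 0 < 2 :> int)) iter_diff2 !HE.
have [n1 n2] := poly_dim12 n; have [m1 m2] := poly_dim12 m.
rewrite /Knm_hilb /= n1 m1.
have -> : 2 * (poly_dim n 2 + poly_dim m 2)%N%:Z =
    n%:Z * (n%:Z + 1) + m%:Z * (m%:Z + 1) :> int by lia.
move=> ge0; move: neg; apply/negP; rewrite -leNgt; apply: le_trans ge0 _.
by rewrite le_eqVlt; apply/orP; left; apply/eqP; rewrite -addn1 !PoszD; ring.
Qed.

(** The size bound covers every module with this Hilbert series, so it gives both the exact depth of
    the constructed [N] and the maximality of that depth. *)
Lemma Knm_hdepth (K : fieldType) (n m : nat) : (0 < m <= n)%N ->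
  n%:Z * (n%:Z + 1) + m%:Z * (m%:Z + 1) - 2 * ((uphalf n)%:Z + 1) * (n%:Z +
    m%:Z) +
    ((uphalf n)%:Z + 1) * (uphalf n)%:Z < 0 ->
  is_hdepth (Knm_module K n m) (uphalf n).
Proof.
move=> mn neg; have [N [Nfg NH Nreg]] := Knm_hdepth_ge K mn.
have hnm : (uphalf n <= n + m)%N by lia.
split.
  exists N; split=> //; split.
    exists (vars K (n + m) (uphalf n)); split=> //; first exact: size_vars.
    move=> p /mem_take /mapP[i _ ->]; rewrite mcoeffX.
    by rewrite mnm1_eq0.
  by move=> r [rs [<- rs0 reg]]; apply: Knm_regular_seq_size NH rs0 reg.
by move=> r [N' [_ N'H [[rs [<- rs0 reg]] _]]];
  apply: Knm_regular_seq_size N'H rs0 reg.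
Qed.

(** The interval says that 2t - 1 lies strictly between -x and x; multiplying the two positive
    differences returns to integers. *)
Lemma sqrt_interval (R : realType) (a t : int) : 0 <= a ->
  (1 - Num.sqrt (a%:~R : R)) / 2 < t%:~R ->
  t%:~R < (1 + Num.sqrt (a%:~R : R)) / 2 -> (2 * t - 1) ^+ 2 < a.
Proof.
move=> a0; set x := Num.sqrt _ => lt1 lt2.
have xx : x ^+ 2 = a%:~R by rewrite sqr_sqrtr // ler0z.
rewrite -(ltr_int R) -xx rmorphXn /= rmorphB rmorphM /=.
have : 0 < (x - (2 * t%:~R - 1)) * (x + (2 * t%:~R - 1)).
  by apply: mulr_gt0; lra.
by rewrite -subr_gt0 => /lt_le_trans; apply; rewrite le_eqVlt; apply/orP; left;
  apply/eqP; ring.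
Qed.

Theorem theorem3p1 (K : fieldType) (R : realType) (n m : nat) (s t : int)
    (hnm : (n >= m)%N) (hm : (m >= 1)%N) :
  (n%:Z = 2 * s -> m%:Z = s + t ->
   (1 - Num.sqrt (1 + 8 * s%:~R)) / 2 < t%:~R :> R ->
   t%:~R < (1 + Num.sqrt (1 + 8 * s%:~R)) / 2 :> R ->
   exists2 h : nat, is_hdepth (Knm_module K n m) h & h%:Z = s)
  /\
  (n%:Z = 2 * s + 1 -> m%:Z = s + 1 + t ->
   (1 - Num.sqrt (9 + 16 * s%:~R)) / 2 < t%:~R :> R ->
   t%:~R < (1 + Num.sqrt (9 + 16 * s%:~R)) / 2 :> R ->
   exists2 h : nat, is_hdepth (Knm_module K n m) h & h%:Z = s + 1).
Proof.
have mn : (0 < m <= n)%N by rewrite hm hnm.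
split=> nE mE lt1 lt2; exists (uphalf n); try lia; apply: Knm_hdepth => //.
  have hE : (uphalf n)%:Z = s by lia.
  have : (2 * t - 1) ^+ 2 < 1 + 8 * s.
    by apply: (@sqrt_interval R); rewrite ?rmorphD ?rmorphM //=; lia.
  (* The expression equals t^2 - t - 2s, a quarter of (2t-1)^2 - (1+8s). *)
  rewrite nE mE hE => lt; nia.
have hE : (uphalf n)%:Z = s + 1 by lia.
have : (2 * t - 1) ^+ 2 < 9 + 16 * s.
  by apply: (@sqrt_interval R); rewrite ?rmorphD ?rmorphM //=; lia.
(* Here it equals t^2 - t - 4s - 2, a quarter of (2t-1)^2 - (9+16s). *)
rewrite nE mE hE => lt; nia.
Qed.
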